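(* Let $k,m\ge 1$ be integers, $T>0$, $0<\alpha_n<1$ for $n=1,\dots,k+m$, let $a_1=1$ and $a_2,\dots,a_{k+m}$ be nonzero real numbers, and let $B=(b_{ji})_{j=k+1,\dots,k+m;\ i=1,\dots,k}$ be a real $m\times k$ matrix. Let $b_n=(-\infty,0)$ for $n=1,\dots,k$ and $b_n=(0,+\infty)$ for $n=k+1,\dots,k+m$, and let functions $f_n$ on $b_n\times(0,T]$ and $u_{0,n}$ on $b_n$ be given. Consider the problem of finding $u=(u_1,\dots,u_{k+m})^T$ with $$ \begin{cases} \partial_{0t}^{\alpha_n}u_n(x,t)-u_{n,xxx}(x,t)=f_n(x,t), & x\in b_n,\ t\in(0,T],\ n=1,\dots,k+m,\\ u_n(x,0)=u_{0,n}(x), & x\in b_n,\ n=1,\dots,k+m,\\ u_1(0,t)=a_n u_n(0,t), & t\in[0,T],\ n=2,\dots,k+m,\\ u_{j,x}(0,t)=\sum_{i=1}^{k}b_{ji}\,u_{i,x}(0,t), & t\in[0,T],\ j=k+1,\dots,k+m,\\ \sum_{i=1}^{k}\frac1{a_i}u_{i,xx}(0,t)=\sum_{j=k+1}^{k+m}\frac1{a_j}u_{j,xx}(0,t), & t\in[0,T]. \end{cases} $$ If the symmetric $k\times k$ matrix $B^TB-I$ is negative definite, then this problem has at most one (regular) solution.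
   Context: The problem is posed on a star graph with $k$ incoming edges (coordinate running from $-\infty$ to $0$) and $m$ outgoing edges (coordinate running from $0$ to $+\infty$), all meeting at the vertex $x=0$; $u_n$ is the restriction of the unknown function $u$ to the edge $b_n$. Values $u_n(0,t),u_{n,x}(0,t),u_{n,xx}(0,t)$ at the vertex are limits as $x\to0$ from within $b_n$. For $0<\rho<1$, $\partial_{0t}^{\rho}$ is the Caputo fractional derivative in $t$: $\partial_{0t}^{\rho}g(t)=\frac{1}{\Gamma(1-\rho)}\int_0^t\frac{g'(\xi)}{(t-\xi)^{\rho}}\,d\xi$. Solutions are regular (classical) solutions: the functions and all derivatives involved in the problem exist and are continuous where they appear, and all the equations and conditions hold pointwise. It is a standing assumption that $u_n$, $u_{n,x}$, $u_{n,xx}$, and more generally the functions and their derivatives involved in the equation, vanish as $|x|\to\infty$ along each edge. *)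

(* Defs.v *)
From HB Require Import structures.
From mathcomp Require Import all_boot all_order all_algebra.
From mathcomp Require Import all_classical all_reals all_analysis.

Set Implicit Arguments.
Unset Strict Implicit.
Unset Printing Implicit Defensive.

Import Order.TTheory GRing.Theory Num.Theory.
Import numFieldNormedType.Exports.

Local Open Scope classical_set_scope.
Local Open Scope ring_scope.

Definition Gamma (R : realType) (a : R) : R :=
  \int[@lebesgue_measure R]_(s in `]0, +oo[) (s `^ (a - 1) * expR (- s)).

Definition caputo_integrand (R : realType) (rho : R) (g : R -> R) (t xi : R) :
  R := derive1 g xi / (t - xi) `^ rho.

(* [Rintegral] is total: the value is meaningful only when the integrand is
   integrable, which [regular_on_edge] below requires. *)
Definition caputo (R : realType) (rho : R) (g : R -> R) (t : R) : R :=
  (Gamma (1 - rho))^-1 *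
  \int[@lebesgue_measure R]_(xi in `]0, t[) caputo_integrand rho g t xi.

(* Edges are numbered from 0: those of index [n < k] are incoming, the others
   outgoing.  The vertex is not a point of any edge. *)
Definition edge (R : realType) (k m : nat) (n : 'I_(k + m)) : set R :=
  if (n < k)%N then `]-oo, 0[%classic else `]0, +oo[%classic.
Arguments edge R {k m} n.

Definition first_edge (k m : nat) (hk : (0 < k)%N) : 'I_(k + m) :=
  lshift m (Ordinal hk).

(* Functions on an edge have type [R -> R -> R], position first, time second. *)
Definition dx (R : realType) (j : nat) (v : R -> R -> R) (x t : R) : R :=
  derive1n j (v^~ t) x.

Definition dt (R : realType) (v : R -> R -> R) (x t : R) : R := derive1 (v x) t.

Definition caputo_dt (R : realType) (rho : R) (v : R -> R -> R) (x t : R) : R :=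
  caputo rho (v x) t.

Definition vertex_value (R : realType) (b : set R) (g : R -> R -> R) (t : R) :
  R := lim (g x t @[x --> within b (nbhs (0 : R))]).

Definition continuous_on (R : realType) (b I : set R) (g : R -> R -> R) : Prop :=
  {within b `*` I, continuous (fun p : R * R => g p.1 p.2)}.

(* Values of [g] at the vertex play no role: it is the limits from inside the
   edge that complete [g] to a continuous function on [closure b `*` I]. *)
Definition continuous_up_to_vertex (R : realType) (b I : set R)
    (g : R -> R -> R) : Prop :=
  exists2 h : R -> R -> R, continuous_on (closure b) I h &
    forall x t, x \in b -> t \in I -> h x t = g x t.

(* [g(x, t) -> 0] as [|x| -> oo] along [b], locally uniformly in [t \in I]. *)
Definition vanishes_at_infinity (R : realType) (b I : set R)
    (g : R -> R -> R) : Prop :=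
  forall K : set R, compact K -> K `<=` I ->
  forall e : R, 0 < e ->
  exists M : R, forall x t : R,
    x \in b -> t \in K -> M < `|x| -> `|g x t| < e.

(* The time derivative is needed on [0 < t < T] only, where it enters the
   Caputo integral; [u], [u_x], [u_xx] occur in the vertex conditions on all of
   [0 <= t <= T], [u_xxx] and the Caputo derivative in the equation on
   [0 < t <= T]. *)
Record regular_on_edge (R : realType) (b : set R) (rho T : R)
    (v : R -> R -> R) : Prop := RegularOnEdge {
  regular_derivable_x : forall (j : nat) (x t : R), (j < 2)%N ->
    x \in b -> t \in `[0, T] -> derivable (fun y => dx j v y t) x 1;
  regular_continuous_x : forall j : nat, (j <= 2)%N ->
    continuous_up_to_vertex b `[0, T] (dx j v);
  regular_derivable_xxx : forall x t : R,
    x \in b -> t \in `]0, T] -> derivable (fun y => dx 2 v y t) x 1;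
  regular_continuous_xxx : continuous_on b `]0, T] (dx 3 v);
  regular_derivable_t : forall x t : R,
    x \in b -> t \in `]0, T[ -> derivable (v x) t 1;
  regular_continuous_t : continuous_on b `]0, T[ (dt v);
  regular_integrable_caputo : forall x t : R, x \in b -> t \in `]0, T] ->
    (@lebesgue_measure R).-integrable `]0, t[
      (EFin \o caputo_integrand rho (v x) t);
  regular_continuous_caputo : continuous_on b `]0, T] (caputo_dt rho v);
  regular_vanishes_x : forall j : nat, (j <= 2)%N ->
    vanishes_at_infinity b `[0, T] (dx j v);
  regular_vanishes_xxx : vanishes_at_infinity b `]0, T] (dx 3 v);
  regular_vanishes_caputo : vanishes_at_infinity b `]0, T] (caputo_dt rho v)
}.

(* [u n x t] is the value on edge [n]; only [x \in edge n], [0 <= t <= T] are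
   relevant.  The rows of [B] correspond to the outgoing edges [rshift k j],
   its columns to the incoming edges [lshift m i]. *)
Record regular_solution (R : realType) (k m : nat) (hk : (0 < k)%N) (T : R)
    (alpha a : 'I_(k + m) -> R) (B : 'M[R]_(m, k))
    (f : 'I_(k + m) -> R -> R -> R) (u0 : 'I_(k + m) -> R -> R)
    (u : 'I_(k + m) -> R -> R -> R) : Prop := RegularSolution {
  solution_regular : forall n, regular_on_edge (edge R n) (alpha n) T (u n);
  solution_equation : forall n x t, x \in edge R n -> t \in `]0, T] ->
    caputo_dt (alpha n) (u n) x t - dx 3 (u n) x t = f n x t;
  solution_initial : forall n x, x \in edge R n -> u n x 0 = u0 n x;
  solution_vertex : forall n t, n != first_edge m hk -> t \in `[0, T] ->
    vertex_value (edge R (first_edge m hk)) (u (first_edge m hk)) t =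
    a n * vertex_value (edge R n) (u n) t;
  solution_vertex_x : forall (j : 'I_m) t, t \in `[0, T] ->
    vertex_value (edge R (rshift k j)) (dx 1 (u (rshift k j))) t =
    \sum_(i < k) B j i *
      vertex_value (edge R (lshift m i)) (dx 1 (u (lshift m i))) t;
  solution_vertex_xx : forall t, t \in `[0, T] ->
    \sum_(i < k) (a (lshift m i))^-1 *
      vertex_value (edge R (lshift m i)) (dx 2 (u (lshift m i))) t =
    \sum_(j < m) (a (rshift k j))^-1 *
      vertex_value (edge R (rshift k j)) (dx 2 (u (rshift k j))) t
}.

Definition negative_definite (R : realType) (k : nat) (M : 'M[R]_k) : Prop :=
  M^T = M /\ forall z : 'cV[R]_k, z != 0 -> (z^T *m M *m z) 0 0 < 0.

(* Main.v *)
Require Import Defs.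
From mathcomp Require Import all_boot all_order all_algebra.
From mathcomp Require Import all_classical all_reals all_analysis.
From mathcomp Require Import measurable_realfun ring lra.
Import Order.TTheory GRing.Theory Num.Theory.
Import numFieldNormedType.Exports.
Local Open Scope classical_set_scope.
Local Open Scope ring_scope.

(* Let [w] be the difference of two solutions and, on each edge,
   [H = w w_xx - w_x ^ 2 / 2], so that [H_x = w w_xxx = w D w] with [D] the
   Caputo derivative.  Alikhanov's inequality [2 g D g >= D (g ^ 2)] and
   [g 0 = 0] give [\int_0^tau w D w dt >= 0], with equality only if [w = 0]
   before [tau].  Hence [G x = \int_0^tau H x t dt] is nondecreasing in [x]
   along every edge; it tends to [0] at infinity, even though [w] need not be
   square integrable.  So [G] is [>= 0] at the vertex on incoming edges and
   [<= 0] on outgoing ones, whereas the vertex conditions and [B^T B <= I] make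
   the incoming values sum to at most the outgoing ones.  Thus [G = 0] on every
   edge, and the equality case gives [w = 0]. *)

Set Implicit Arguments.
Unset Strict Implicit.
Unset Printing Implicit Defensive.

(** * Integration on segments *)

(** The sign and the equality case come from one integration by parts. Up to the Gamma factor,
    integrating [D (w ^ 2)] over [[0, tau]] gives the convolution of the derivative of [w ^ 2] with
    [kernel_primitive]; since [w] is [0] at time [0], this is the integral of
    [w ^ 2 * (tau - s) ^- a], which is nonnegative and vanishes only with [w]. The regularity
    available shapes the estimates. The Caputo derivative and [w_xxx] are continuous for [t > 0]
    only, so everything is first done on [[ep, tau]] and [ep] then tends to [0]. The time derivative
    of [w] exists for [t < T] only, so [tau] stays below [T] and the last instant is reached by
    continuity. The orders [alpha n] may differ from edge to edge, so the edges cannot be added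
    before the time operator is removed. Each edge therefore contributes only a sign, carried by the
    plain time integral of [H], which has no weight depending on the order and can be compared
    across edges at the vertex. *)

Lemma within_continuousM (R : realType) (V : topologicalType) (A : set V)
    (f g : V -> R) :
  {within A, continuous f} -> {within A, continuous g} ->
  {within A, continuous (fun x => f x * g x)}.
Proof. by move=> cf cg x; apply: cvgM; [exact: cf|exact: cg]. Qed.

Lemma integrable_cc_oo (R : realType) (a b : R) (f : R -> R) :
  (@lebesgue_measure R).-integrable `]a, b[ (EFin \o f) ->
  (@lebesgue_measure R).-integrable `[a, b] (EFin \o f).
Proof.
move=> /integrableP[mf intf]; apply/integrableP; split.
  exact: emeasurable_fun_itv_cc mf.
rewrite integral_itv_bndoo//.
exact: measurableT_comp.
Qed.

Lemma Rintegral_cc_oo (R : realType) (a b : R) (f : R -> R) :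
  (@lebesgue_measure R).-integrable `]a, b[ (EFin \o f) ->
  \int[@lebesgue_measure R]_(x in `]a, b[) f x =
  \int[@lebesgue_measure R]_(x in `[a, b]) f x.
Proof.
move=> intf; rewrite /Rintegral [in RHS]integral_itv_bndoo//.
exact: (measurable_int _ intf).
Qed.

Lemma primitive_continuous (R : realType) (a b : R) (f : R -> R) : a <= b ->
  (@lebesgue_measure R).-integrable `[a, b] (EFin \o f) ->
  {within `[a, b], continuous
     (fun p => \int[@lebesgue_measure R]_(x in `[a, p]) f x)}.
Proof. exact: parameterized_integral_continuous. Qed.

Lemma primitive_is_derive (R : realType) (a b p : R) (f : R -> R) :
  a < p -> p < b -> (@lebesgue_measure R).-integrable `[a, b] (EFin \o f) ->
  {for p, continuous f} ->
  is_derive p 1 (fun p => \int[@lebesgue_measure R]_(x in `[a, p]) f x) (f p).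
Proof.
move=> ap pb intf cf.
have [dF F'] := continuous_FTC1_closed pb intf ap cf.
by apply: DeriveDef; [exact: dF|rewrite -derive1E].
Qed.

Section itv_integrable.
Context (R : realType) (A : interval R).
Implicit Types f g : R -> R.
Local Notation integrable f :=
  ((@lebesgue_measure R).-integrable [set` A] (EFin \o f)).

Lemma itv_integrableS (B : interval R) f : [set` A] `<=` [set` B] ->
  (@lebesgue_measure R).-integrable [set` B] (EFin \o f) -> integrable f.
Proof. by move=> AB; apply: integrableS. Qed.

Lemma eq_itv_integrable f g : (forall s, s \in A -> f s = g s) ->
  integrable f -> integrable g.
Proof.
by move=> fg; apply: eq_integrable => // s /[!inE]/= As; rewrite /= fg.
Qed.

Lemma itv_integrableD f g : integrable f -> integrable g ->
  integrable (fun s => f s + g s).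
Proof.
move=> fi gi.
by apply: (@integrableD _ _ _ (@lebesgue_measure R) _ _ (EFin \o f) (EFin \o g)).
Qed.

Lemma itv_integrableB f g : integrable f -> integrable g ->
  integrable (fun s => f s - g s).
Proof.
move=> fi gi.
by apply: (@integrableB _ _ _ (@lebesgue_measure R) _ _ (EFin \o f) (EFin \o g)).
Qed.

Lemma itv_integrableZl (k : R) f : integrable f -> integrable (fun s => k * f s).
Proof. by move=> fi; apply: (@integrableZl _ _ _ (@lebesgue_measure R) _ _ k (EFin \o f)). Qed.

End itv_integrable.

(** * The kernel of the Caputo derivative *)

Lemma is_derive1_subl (R : realType) (f : R -> R) (t p d : R) :
  is_derive (t - p) 1 f d -> is_derive p 1 (fun q => f (t - q)) (- d).
Proof.
move=> df.
have ds : is_derive p 1 (fun q : R => t - q) (-1).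
  by have := is_deriveB (is_derive_cst t p 1) (is_derive_id p 1); rewrite sub0r.
by have := @is_derive1_comp R f (fun q => t - q) p d (-1) df ds; rewrite mulrN1.
Qed.

(* The primitive, extended by [0] to the left of [0], of the kernel [s ^- a] of
   the Caputo derivative of order [a]. *)
Definition kernel_primitive (R : realType) (a s : R) : R :=
  if s <= 0 then 0 else s `^ (1 - a) / (1 - a).

Lemma kernel_primitive_le0 (R : realType) (a s : R) :
  s <= 0 -> kernel_primitive a s = 0.
Proof. by rewrite /kernel_primitive => ->. Qed.

Lemma kernel_primitive_is_derive (R : realType) (a s : R) : a < 1 -> 0 < s ->
  is_derive s 1 (kernel_primitive a) (s `^ a)^-1.
Proof.
move=> a1 s0.
have E : {near s, (fun r => (1 - a)^-1 * r `^ (1 - a)) =1 kernel_primitive a}.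
  near=> r; rewrite /kernel_primitive leNgt ifN; first by rewrite mulrC.
  by rewrite negbK; near: r; exact: lt_nbhsr.
have D : is_derive s 1 (fun r => (1 - a)^-1 * r `^ (1 - a)) (s `^ a)^-1.
  have := @is_derive1_powR R (1 - a) s s0.
  move/(is_deriveZ (1 - a)^-1) => D; apply: is_derive_eq.
  rewrite /GRing.scale/= mulrA mulVf ?mul1r ?subr_eq0 ?gt_eqF//.
  by rewrite addrAC subrr add0r powRN.
case: D => D1 D2; apply: DeriveDef; first exact: near_eq_derivable D1.
by rewrite -D2; apply: near_eq_derive; near do apply/esym; exact: E.
Unshelve. all: end_near. Qed.

Lemma kernel_primitive_continuous (R : realType) (a : R) : a < 1 ->
  continuous (kernel_primitive a).
Proof.
move=> a1 s; have [s0|s0|->] := ltgtP s 0.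
- apply: (@near_cst_continuous _ _ 0).
  near=> r; rewrite kernel_primitive_le0//; apply: ltW.
  by near: r; exact: lt_nbhsl.
- have [+ _] := kernel_primitive_is_derive a1 s0.
  by move=> /derivable1_diffP/differentiable_continuous.
- apply/left_right_continuousP; rewrite kernel_primitive_le0//; split.
    apply: cvg_near_cst; near=> r; apply/kernel_primitive_le0.
    by near: r; exact: nbhs_left_le.
  have : (fun r => r `^ (1 - a) / (1 - a)) r @[r --> 0^'+] --> (0 : R).
    rewrite -[X in _ --> X](mul0r (1 - a)^-1).
    by apply: cvgMl; apply: powR_cvg0; rewrite subr_gt0.
  apply: cvg_trans; apply: near_eq_cvg; near=> r.
  by rewrite /kernel_primitive leNgt ifN// negbK; near: r; exact: nbhs_right_gt.
Unshelve. all: end_near. Qed.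

Lemma kernel_primitive_ge0 (R : realType) (a s : R) : a < 1 ->
  0 <= kernel_primitive a s.
Proof.
move=> a1; rewrite /kernel_primitive; case: ifP => // _.
by rewrite divr_ge0 ?powR_ge0// subr_ge0 ltW.
Qed.

(** Mean value theorem, the kernel being decreasing. In [convolution_right_increment] the upper
    bound serves where the integrand is nonnegative and the lower bound where it is negative. *)
Lemma kernel_primitive_increment (R : realType) (a s r : R) :
  0 < a < 1 -> 0 < s -> s <= r ->
  (r - s) * (r `^ a)^-1 <= kernel_primitive a r - kernel_primitive a s <=
  (r - s) * (s `^ a)^-1.
Proof.
move=> /andP[a0 a1] s0 sr.
have [||c csr ->] := @MVT_segment R (kernel_primitive a)
    (fun s => (s `^ a)^-1) s r sr.
- move=> x /[!in_itv]/= /andP[sx _]; apply: kernel_primitive_is_derive => //.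
  exact: lt_trans sx.
- by apply: continuous_subspaceT => x; exact: kernel_primitive_continuous.
move: csr; rewrite in_itv/= => /andP[sc cr].
have c0 : 0 < c by exact: lt_le_trans sc.
have r0 : 0 < r by exact: lt_le_trans cr.
rewrite [X in _ <= X <= _]mulrC !ler_wpM2l ?subr_ge0//.
  by rewrite lef_pV2 ?posrE ?powR_gt0// ge0_ler_powR// ?nnegrE ltW.
by rewrite lef_pV2 ?posrE ?powR_gt0// ge0_ler_powR// ?nnegrE ltW.
Qed.

Lemma kernel_primitive_le (R : realType) (a s r : R) : a < 1 -> s <= r ->
  kernel_primitive a s <= kernel_primitive a r.
Proof.
move=> a1 sr; have [s0|s0] := leP s 0.
  by rewrite (kernel_primitive_le0 _ s0) kernel_primitive_ge0.
have r0 := lt_le_trans s0 sr.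
rewrite /kernel_primitive ![_ <= 0]leNgt s0 r0/= ler_wpM2r//.
  by rewrite invr_ge0 subr_ge0 ltW.
by rewrite ge0_ler_powR ?nnegrE ?subr_ge0// ltW.
Qed.

Lemma integrable_continuousM (R : realType) (a b : R) (phi f : R -> R) :
  {within `[a, b], continuous phi} ->
  (@lebesgue_measure R).-integrable `[a, b] (EFin \o f) ->
  (@lebesgue_measure R).-integrable `[a, b] (EFin \o (fun s => phi s * f s)).
Proof.
move=> cphi intf.
apply: (@integrableMr _ _ _ (@lebesgue_measure R) _ _ phi (EFin \o f)) => //.
  exact: subspace_continuous_measurable_fun.
have /compact_bounded[M [_ mrt]] :=
  continuous_compact cphi (@segment_compact _ a b).
by exists M; split; rewrite ?num_real // => ? ? ? ?; exact: mrt.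
Qed.

Lemma in_itvoo_cc (R : realType) (a b c d x : R) :
  a <= c -> d <= b -> x \in `]c, d[ -> x \in `]a, b[.
Proof.
rewrite !in_itv/= => ac db /andP[cx xd].
by rewrite (le_lt_trans ac)// (lt_le_trans xd).
Qed.

Lemma subset_itvcc (R : realType) (a b c d : R) :
  a <= c -> d <= b -> `[c, d] `<=` `[a, b].
Proof.
move=> ac db x /=; rewrite !in_itv/= => /andP[cx xd].
by rewrite (le_trans ac cx) (le_trans xd db).
Qed.

Lemma kernel_primitive_subl_continuous (R : realType) (a t : R) : a < 1 ->
  continuous (fun s => kernel_primitive a (t - s)).
Proof.
move=> a1 x; apply: (@continuous_comp _ _ _ (fun s => t - s)).
  by apply: cvgB; [exact: cvg_cst|exact: cvg_id].
exact: kernel_primitive_continuous.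
Qed.

Lemma mvt_ge (R : realType) (F F' : R -> R) (p q m : R) : p <= q ->
  (forall c : R, c \in `]p, q[ -> is_derive c 1 F (F' c)) ->
  {within `[p, q], continuous F} ->
  (forall c : R, c \in `]p, q[ -> m <= F' c) ->
  (q - p) * m <= F q - F p.
Proof.
rewrite le_eqVlt => /predU1P[->|pq] dF cF mF; first by rewrite !subrr mul0r.
have [c cpq E] := MVT pq dF cF.
by rewrite E mulrC ler_wpM2r ?mF// subr_ge0 ltW.
Qed.

(** * Bounds for the convolution with the kernel primitive *)

Section convolution_bounds.
Context (R : realType) (a t : R) (h h' : R -> R).
Context (a01 : 0 < a < 1) (t0 : 0 < t).
Context (ch : {within `[0, t], continuous h}).
Context (dh : forall p : R, p \in `]0, t[ -> is_derive p 1 h (h' p)).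
Context (ch' : forall p : R, p \in `]0, t[ -> {for p, continuous h'}).
Context (ih' : (@lebesgue_measure R).-integrable `[0, t] (EFin \o h')).
Context (h0 : h 0 = 0).

Let iKh' : (@lebesgue_measure R).-integrable `[0, t]
  (EFin \o (fun s => kernel_primitive a (t - s) * h' s)).
Proof.
apply: integrable_continuousM => //; apply: continuous_subspaceT => x.
by apply: kernel_primitive_subl_continuous; case/andP: a01.
Qed.

(** Integration by parts, stated as the existence of an antiderivative [F] of [h p * (t - p) ^- a],
    so that this function, singular at [t], never has to be integrated. The boundary term vanishes
    at [t] because [kernel_primitive] does at [0], and at [0] because [h 0 = 0]. *)
Let convolution_parts : exists F : R -> R, [/\ F 0 = 0,
  F t = \int[@lebesgue_measure R]_(s in `[0, t])
    (kernel_primitive a (t - s) * h' s),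
  {within `[0, t], continuous F} &
  forall p : R, p \in `]0, t[ -> is_derive p 1 F (h p / (t - p) `^ a)].
Proof.
have [_ a1] := andP a01.
exists (fun p => \int[@lebesgue_measure R]_(s in `[0, p])
  (kernel_primitive a (t - s) * h' s) - kernel_primitive a (t - p) * h p).
split.
- by rewrite set_itv1 Rintegral_set1 h0 mulr0 subrr.
- by rewrite subrr kernel_primitive_le0// mul0r subr0.
- apply: within_continuousB; first exact: primitive_continuous (ltW t0) iKh'.
  apply: within_continuousM; last exact: ch.
  apply: continuous_subspaceT => x; exact: kernel_primitive_subl_continuous.
- move=> p pt; have /andP[p0 pt'] : 0 < p < t by rewrite in_itv/= in pt.
  have cKh' : {for p, continuous (fun s => kernel_primitive a (t - s) * h' s)}.
    by apply: cvgM; [exact: kernel_primitive_subl_continuous|exact: ch'].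
  have d1 := primitive_is_derive p0 pt' iKh' cKh'.
  have tp : 0 < t - p by rewrite subr_gt0.
  have d2 := is_derive1_subl (kernel_primitive_is_derive a1 tp).
  have D := is_deriveB d1 (is_deriveM d2 (dh pt)).
  apply: (is_derive_eq D).
  by rewrite /GRing.scale/=; ring.
Qed.

(** The convolution is [F t - F 0], where [F] has the nonnegative derivative [h p / (t - p) ^ a].
    Between [t1] and [t2] this derivative is at least [m / t ^ a], since [t - p <= t]. The case
    [m = 0] gives the sign, the case [m > 0] its strict form. *)
Lemma convolution_ge (t1 t2 m : R) : 0 <= t1 -> t1 <= t2 -> t2 <= t ->
  (forall p : R, p \in `[0, t] -> 0 <= h p) ->
  0 <= m -> (forall p : R, p \in `]t1, t2[ -> m <= h p) ->
  (t2 - t1) * (m / t `^ a) <=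
  \int[@lebesgue_measure R]_(s in `[0, t]) (kernel_primitive a (t - s) * h' s).
Proof.
move=> t10 t12 t2t h_ge0 m0 hm.
have [F [F0 Ft cF dF]] := convolution_parts.
have F_mvt (p q l : R) : 0 <= p -> p <= q -> q <= t ->
    (forall c : R, c \in `]p, q[ -> l <= h c / (t - c) `^ a) ->
    (q - p) * l <= F q - F p.
  move=> p0 pq qt hl.
  have d (x : R) (xpq : x \in `]p, q[) := dF x (in_itvoo_cc p0 qt xpq).
  exact: mvt_ge pq d (continuous_subspaceW (subset_itvcc p0 qt) cF) hl.
have ge0 p q : 0 <= p -> p <= q -> q <= t -> F p <= F q.
  move=> p0 pq qt; rewrite -subr_ge0 -[leLHS](mulr0 (q - p)).
  apply: F_mvt => // c /[!in_itv]/= /andP[pc cq].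
  rewrite divr_ge0 ?powR_ge0// h_ge0// in_itv/=.
  by rewrite (le_trans p0 (ltW pc))// (le_trans (ltW cq)).
rewrite -Ft -[leRHS]subr0 -F0.
have -> : F t - F 0 = (F t - F t2) + (F t1 - F 0) + (F t2 - F t1) by ring.
have := ge0 _ _ (le_trans t10 t12) t2t (lexx t).
have := ge0 _ _ (lexx 0) t10 (le_trans t12 t2t).
have : (t2 - t1) * (m / t `^ a) <= F t2 - F t1.
  apply: F_mvt => // c c12; apply: ler_pM => //.
  - by rewrite invr_ge0 powR_ge0.
  - exact: hm.
  - move: c12; rewrite in_itv/= => /andP[c1 c2].
    have tc : 0 < t - c by rewrite subr_gt0 (lt_le_trans c2).
    rewrite lef_pV2 ?posrE ?powR_gt0//.
    rewrite ge0_ler_powR ?nnegrE ?(ltW tc) ?(ltW t0)//.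
      by case/andP: a01 => /ltW.
    by rewrite gerBl (le_trans t10)// ltW.
lra.
Qed.

(** Adding [M * kernel_primitive a (t - p)] to [F] gives the derivative
    [(h p - M) / (t - p) ^ a <= 0]. The bound controls the energy already present at a small time,
    as [kernel_primitive] tends to [0] there. *)
Lemma convolution_le (M : R) :
  (forall p : R, p \in `[0, t] -> h p <= M) ->
  \int[@lebesgue_measure R]_(s in `[0, t]) (kernel_primitive a (t - s) * h' s)
  <= M * kernel_primitive a t.
Proof.
move=> hM; have [F [F0 Ft cF dF]] := convolution_parts; rewrite -Ft; have [_ a1] := andP a01.
pose G p := F p + M * kernel_primitive a (t - p).
have cG : {within `[0, t], continuous G}.
  apply: within_continuousD => //; apply: continuous_subspaceT => x.
  apply: cvgMr; exact: kernel_primitive_subl_continuous.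
have dG p : p \in `]0, t[ ->
    is_derive p 1 G (h p / (t - p) `^ a + M * - ((t - p) `^ a)^-1).
  move=> pt; apply: is_deriveD; first exact: dF.
  apply: (@is_deriveZ R R R (fun p => kernel_primitive a (t - p))).
  apply: is_derive1_subl; apply: kernel_primitive_is_derive => //.
  by move: pt; rewrite in_itv/= subr_gt0 => /andP[].
have [c ct E] := MVT t0 dG cG.
have : G t - G 0 <= 0.
  rewrite E mulr_le0_ge0 ?subr_ge0 ?(ltW t0)//.
  rewrite mulrN -mulrBl mulr_le0_ge0 ?invr_ge0 ?powR_ge0// subr_le0.
  by apply: hM; exact: subset_itv_oo_cc.
rewrite /G F0 subrr subr0 kernel_primitive_le0//.
lra.
Qed.

End convolution_bounds.

(** * Energy estimate in time *)

Lemma within_continuous_cvg (T U : topologicalType) (A : set T) (f : T -> U) x :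
  {within A, continuous f} -> A x -> f y @[y --> within A (nbhs x)] --> f x.
Proof.
move=> cf Ax V /(cf x).
change ((nbhs_subspace (A := A) x) (f @^-1` V) -> (within A (nbhs x)) (f @^-1` V)).
by rewrite nbhs_subspace_in.
Qed.

Lemma bounded_near_point (R : realType) (f : R -> R) (t : R) :
  {for t, continuous f} ->
  exists2 d : R, 0 < d & forall p, `|t - p| < d -> `|f p| <= `|f t| + 1.
Proof.
move=> /cvgrPdist_lt /(_ _ ltr01)[d /= d0 H]; exists d => // p tp.
have := H p tp => /= /ltW; rewrite distrC => fp.
by rewrite -[f p](subrK (f t)) addrC (le_trans (ler_normD _ _))// lerD2l.
Qed.

(** After adding a slack [e * (s - a)] to [F], the set of [s] at which the sum is at least its value
    at [a] contains its supremum by continuity. The lower bound on right increments then yields a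
    larger element unless the supremum is [b]. *)
Lemma dini_nondecreasing (R : realType) (F : R -> R) (a b : R) : a <= b ->
  {within `[a, b], continuous F} ->
  (forall t e : R, t \in `[a, b[ -> 0 < e -> exists2 d, 0 < d &
     forall eta, 0 < eta < d -> - (e * eta) <= F (t + eta) - F t) ->
  F a <= F b.
Proof.
move=> ab cF dini.
suff H e : 0 < e -> F a <= F b + e * (b - a).
  apply/ler_addgt0Pr => e e0.
  (* The [+ 1] keeps the denominator positive when [a = b]. *)
  have ba : 0 < b - a + 1 by rewrite ltr_wpDl ?subr_ge0.
  apply: le_trans (H (e / (b - a + 1)) _) _; first by rewrite divr_gt0.
  rewrite lerD2l mulrAC -mulrA ger_pMr// ler_pdivrMr// mul1r lerDl.
  exact: ler01.
move=> e0.
pose G s := F s + e * (s - a).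
have cG : {within `[a, b], continuous G}.
  apply: within_continuousD; first exact: cF.
  apply: continuous_subspaceT => x.
  by apply: cvgMr; apply: cvgB; [exact: cvg_id|exact: cvg_cst].
pose A := [set s | s \in `[a, b] /\ G a <= G s].
have Aa : A a by split => //; rewrite in_itv/= lexx.
have ubA : ubound A b by move=> s [] /[!in_itv]/= /andP[].
have supA : has_sup A by split; [exists a|exists b].
pose s := sup A.
have as_ : a <= s by apply: ub_le_sup => //; exists b.
have sb : s <= b by apply: ge_sup => //; exists a.
have Gs : G a <= G s.
  rewrite leNgt; apply/negP => Gsa.
  have /cvgrPdist_lt : G x @[x --> within `[a, b] (nbhs s)] --> G s.
    by apply: within_continuous_cvg; [exact: cG|rewrite /= in_itv/= as_ sb].
  move=> /(_ (G a - G s)); rewrite subr_gt0 => /(_ Gsa)[d /= d0 Hd].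
  have [r [rab Gr] sr] := sup_adherent d0 supA.
  have rs : r <= s by apply: ub_le_sup; [exists b|split].
  have := Hd r; rewrite /= ger0_norm ?subr_ge0// ltrBlDr -ltrBlDl.
  move=> /(_ sr rab); rewrite distrC => /(le_lt_trans (ler_norm _)).
  by rewrite ltrD2r ltNge Gr.
have Eb : G a <= G b.
  move: sb; rewrite le_eqVlt => /predU1P[<-//|sb].
  have sab : s \in `[a, b[ by rewrite in_itv/= as_ sb.
  have [d d0 Hd] := dini s e sab e0.
  pose eta := Num.min (d / 2) ((b - s) / 2).
  have eta0 : 0 < eta by rewrite lt_min !divr_gt0// subr_gt0.
  have etad : eta < d.
    by rewrite gt_min ltr_pdivrMr// ltr_pMr// ltr1n.
  have etab : eta < b - s.
    by rewrite gt_min orbC ltr_pdivrMr// ltr_pMr ?ltr1n// subr_gt0.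
  have : s + eta <= s.
    apply: ub_le_sup; first by exists b.
    split; first by rewrite in_itv/=; apply/andP; split; lra.
    apply: (le_trans Gs); rewrite /G.
    have := Hd eta; rewrite eta0 etad => /(_ isT).
    lra.
  by rewrite gerDl leNgt eta0.
by move: Eb; rewrite /G subrr mulr0 addr0.
Qed.

(* The function [q = (g t - g) ^ 2] vanishes at [t] to second order, and
   integrating [- q' (t - s) ^- a] by parts on [0, p] leaves the boundary term
   [- q p (t - p) ^- a], which tends to [0] with [t - p], and nonnegative terms. *)
Lemma alikhanov (R : realType) (a t T : R) (g g' : R -> R) :
  0 < a < 1 -> 0 < t -> t < T ->
  {within `[0, t], continuous g} ->
  (forall p : R, p \in `]0, T[ -> is_derive p 1 g (g' p)) ->
  (forall p : R, p \in `]0, T[ -> {for p, continuous g'}) ->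
  (@lebesgue_measure R).-integrable `]0, t[
    (EFin \o (fun s => g' s / (t - s) `^ a)) ->
  \int[@lebesgue_measure R]_(s in `]0, t[) (2 * g s * g' s / (t - s) `^ a) <=
  2 * g t * \int[@lebesgue_measure R]_(s in `]0, t[) (g' s / (t - s) `^ a).
Proof.
move=> /andP[a0 a1] t0 tT cg dg cg' iD.
have iDc := integrable_cc_oo iD.
have ccst (c : R) : {within `[0, t], continuous (fun _ : R => c)}.
  by apply: continuous_subspaceT => x; exact: cvg_cst.
have cgg c : {within `[0, t], continuous (fun s => c * g s)}.
  by apply: within_continuousM; [exact: ccst|exact: cg].
(* [psi] is [- q' * (t - s) ^- a], the difference of the two integrands. It is integrable as a
   continuous function times an integrable one, so the claim becomes the nonnegativity of its
   integral. *)
pose psi s := (2 * g t - 2 * g s) * (g' s / (t - s) `^ a).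
have ipsi : (@lebesgue_measure R).-integrable `[0, t] (EFin \o psi).
  apply: integrable_continuousM; last exact: iDc.
  by apply: within_continuousB; [exact: ccst|exact: cgg].
have ipsioo : (@lebesgue_measure R).-integrable `]0, t[ (EFin \o psi).
  by apply: integrableS ipsi => //; exact: subset_itv_oo_cc.
have igt : (@lebesgue_measure R).-integrable `]0, t[
    (EFin \o (fun s => 2 * g t * (g' s / (t - s) `^ a))).
  have : (@lebesgue_measure R).-integrable `[0, t]
    (EFin \o (fun s => 2 * g t * (g' s / (t - s) `^ a))).
    by apply: integrable_continuousM; [exact: ccst|exact: iDc].
  by apply: integrableS => //; exact: subset_itv_oo_cc.
have -> : \int[@lebesgue_measure R]_(s in `]0, t[) (2 * g s * g' s / (t - s) `^ a) =
    2 * g t * \int[@lebesgue_measure R]_(s in `]0, t[) (g' s / (t - s) `^ a)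
    - \int[@lebesgue_measure R]_(s in `[0, t]) psi s.
  rewrite -RintegralZl// -Rintegral_cc_oo// -RintegralB//.
  by apply: eq_Rintegral => s _; rewrite /psi; ring.
rewrite gerBl.
pose Q p := (g t - g p) ^+ 2 * (t - p) `^ (- a).
have dpow p : p < t ->
    is_derive p 1 (fun p => (t - p) `^ (- a)) (a * (t - p) `^ (- a - 1)).
  move=> pt; have tp : 0 < t - p by rewrite subr_gt0.
  have := is_derive1_subl (is_derive1_powR (- a) tp).
  by rewrite mulNr opprK.
(* The sum of the integral of [psi] and of [Q] has derivative [a * q * (t - c) ^ (- a - 1) >= 0],
   the terms with [g'] cancelling, and its value at [0] is [Q 0 >= 0]. *)
have step p : p \in `]0, t[ ->
    - Q p <= \int[@lebesgue_measure R]_(s in `[0, p]) psi s.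
  move=> /[!in_itv]/= /andP[p0 pt].
  have p0t : `[0, p] `<=` `[0, t] by exact: subset_itvcc (ltW pt).
  have cF : {within `[0, p], continuous
      (fun q => \int[@lebesgue_measure R]_(s in `[0, q]) psi s + Q q)}.
    apply: within_continuousD.
      apply: primitive_continuous (ltW p0) _.
      by apply: integrableS ipsi.
    apply: (@within_continuousM _ _ _ (fun q => (g t - g q) ^+ 2)
      (fun q => (t - q) `^ (- a))).
      apply: (@within_continuousM _ _ _ (fun q => g t - g q)
        (fun q => g t - g q));
        (apply: within_continuousB; apply: continuous_subspaceW p0t _;
          [exact: ccst|exact: cg]).
    apply: derivable_within_continuous => q /[!in_itv]/= /andP[_ qp].
    by case: (dpow q (le_lt_trans qp pt)).
  have dF (c : R) : c \in `]0, p[ -> is_derive c 1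
      (fun q => \int[@lebesgue_measure R]_(s in `[0, q]) psi s + Q q)
      ((g t - g c) ^+ 2 * (a * (t - c) `^ (- a - 1))).
    move=> /[!in_itv]/= /andP[c0 cp].
    have ct : c < t := lt_trans cp pt.
    have cT : c \in `]0, T[ by rewrite in_itv/= c0 (lt_trans ct).
    have [dpc _] := dpow c ct.
    have [dgc _] := dg c cT.
    have cpow : {for c, continuous (fun s => (t - s) `^ (- a))}.
      by apply: differentiable_continuous; exact/derivable1_diffP.
    have cpsi : {for c, continuous psi}.
      have -> : psi = (fun s => (2 * g t - 2 * g s) * (g' s * (t - s) `^ (- a))).
        by apply/funext => s; rewrite powRN.
      apply: cvgM; [apply: cvgB; [exact: cvg_cst|]|apply: cvgM].
      - apply: cvgMr; apply: differentiable_continuous.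
        exact/derivable1_diffP.
      - exact: cg'.
      - exact: cpow.
    have d1 := primitive_is_derive c0 ct ipsi cpsi.
    have d2 := is_deriveB (is_derive_cst (g t) c 1) (dg _ cT).
    have D := is_deriveD d1 (is_deriveM (is_deriveX 2 d2) (dpow _ ct)).
    apply: (is_derive_eq D).
    have E : (cst (g t) - g) c = g t - g c by [].
    by rewrite /psi /GRing.scale/= powRN fctE E; ring.
  have := mvt_ge (ltW p0) dF cF _.
  move=> /(_ 0); rewrite mulr0 set_itv1 Rintegral_set1 add0r.
  have Q0 : 0 <= Q 0 by rewrite mulr_ge0 ?sqr_ge0 ?powR_ge0.
  have H (c : R) : c \in `]0, p[ ->
      0 <= (g t - g c) ^+ 2 * (a * (t - c) `^ (- a - 1)).
    by move=> _; rewrite mulr_ge0 ?sqr_ge0// mulr_ge0 ?powR_ge0// ltW.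
  move=> /(_ H).
  lra.
(* By the mean value theorem [q p] is at most [(t - p) ^ 2] times the square of a bound of [g'] near
   [t]; such a bound exists because [t < T]. One factor [t - p] then absorbs [(t - p) ^- a], as
   [t - p < 1]. *)
have Q0 : \forall p \near t^'-, Q p <= ((`|g' t| + 1) ^+ 2) * (t - p).
  have tT' : t \in `]0, T[ by rewrite in_itv/= t0 tT.
  have [d d0 Hd] := bounded_near_point (cg' t tT').
  near=> p.
  have pt : p < t by near: p; exact: nbhs_left_lt.
  have p0 : 0 < p by near: p; exact: nbhs_left_gt.
  have tp0 : 0 < t - p by rewrite subr_gt0.
  have tp1 : t - p < 1 by near: p; exact: nbhs_left_ltBl.
  have tpd : t - p < d by near: p; exact: nbhs_left_ltBl.
  have dgp (x : R) : x \in `]p, t[ -> is_derive x 1 g (g' x).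
    move=> xpt; apply: dg; exact: in_itvoo_cc (ltW p0) (ltW tT) xpt.
  have cgp := continuous_subspaceW (subset_itvcc (ltW p0) (lexx t)) cg.
  have [c cpt E] := MVT pt dgp cgp.
  rewrite /Q E exprMn -mulrA ler_pM ?sqr_ge0//.
  - by rewrite mulr_ge0 ?sqr_ge0 ?powR_ge0.
  - rewrite -[leLHS]real_normK ?num_real// lerXn2r ?nnegrE ?addr_ge0//.
    apply: Hd; move: cpt; rewrite in_itv/= => /andP[pc ct].
    by rewrite gtr0_norm ?subr_gt0// (le_lt_trans _ tpd)// lerB// ltW.
  - rewrite expr2 -mulrA ger_pMr// powRN ler_pdivrMr ?powR_gt0// mul1r.
    by rewrite ger1_powR ?tp0 ?(ltW tp1)// ltW.
have : (fun p => \int[@lebesgue_measure R]_(s in `[0, p]) psi s +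
    (`|g' t| + 1) ^+ 2 * (t - p)) p @[p --> t^'-] -->
    \int[@lebesgue_measure R]_(s in `[0, t]) psi s.
  rewrite -[X in _ --> X]addr0; apply: cvgD.
    exact: (parameterized_integral_cvg_at_left t0 ipsi).
  rewrite -(mulr0 ((`|g' t| + 1) ^+ 2)) -(subrr t).
  apply: cvgMr; apply: cvgB; first exact: cvg_cst.
  exact: cvg_at_left_filter.
move=> C; apply: (cvgr_to_ge C); near=> p.
have H1 : - Q p <= \int[@lebesgue_measure R]_(s in `[0, p]) psi s.
  apply: step; rewrite in_itv/=; apply/andP; split; near: p.
    exact: nbhs_left_gt.
  exact: nbhs_left_lt.
have H2 : Q p <= ((`|g' t| + 1) ^+ 2) * (t - p) by near: p; exact: Q0.
move: H1 H2; lra.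
Unshelve. all: end_near. Qed.

Lemma kernel_inv_le (R : realType) (a r s : R) : 0 <= a -> 0 < r -> r <= s ->
  (s `^ a)^-1 <= (r `^ a)^-1.
Proof.
move=> a0 r0 rs; have s0 := lt_le_trans r0 rs.
rewrite lef_pV2 ?posrE ?powR_gt0//.
by rewrite ge0_ler_powR ?nnegrE ?(ltW r0) ?(ltW s0).
Qed.

(** Over []t, t + eta]] the kernel primitive is at most [kernel_primitive a eta], which is small,
    and [f] is bounded near [t]. Over []0, t[] the increment of the kernel primitive lies between
    [eta] times the kernel at [t + eta - s] and [eta] times the kernel at [t - s]; the error is
    bounded by [eta] times the integral of the gap between the two kernels against the absolute
    value of [f], which tends to [0] by domination. *)
Lemma convolution_right_increment (R : realType) (a t b : R) (f : R -> R) :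
  0 < a < 1 -> 0 < t -> t < b ->
  (@lebesgue_measure R).-integrable `[0, b] (EFin \o f) ->
  {for t, continuous f} ->
  (@lebesgue_measure R).-integrable `]0, t[
    (EFin \o (fun s => f s / (t - s) `^ a)) ->
  forall e : R, 0 < e -> exists2 d : R, 0 < d & forall eta, 0 < eta < d ->
  \int[@lebesgue_measure R]_(s in `[0, t + eta])
    (kernel_primitive a (t + eta - s) * f s) -
  \int[@lebesgue_measure R]_(s in `[0, t]) (kernel_primitive a (t - s) * f s)
  <= eta *
    (\int[@lebesgue_measure R]_(s in `]0, t[) (f s / (t - s) `^ a) + e).
Proof.
move=> /andP[a0 a1] t0 tb intf cf iD e e0.
have a01 : 0 < a < 1 by rewrite a0.
have [d1 d10 fbnd] := bounded_near_point cf.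
pose L := `|f t| + 1.
have L0 : 0 < L by rewrite ltr_wpDl.
have [d2 d20 Kbnd] : exists2 d2 : R, 0 < d2 &
    forall r, 0 < r < d2 -> kernel_primitive a r * L <= e / 2.
  have := @kernel_primitive_continuous R a a1 0.
  move=> /cvgrPdist_lt /(_ (e / 2 / L)).
  rewrite !divr_gt0// => /(_ isT)[d2 /= d20 H]; exists d2 => // r /andP[r0 rd].
  have := H r; rewrite /= sub0r normrN gtr0_norm// => /(_ rd).
  rewrite [kernel_primitive a 0]kernel_primitive_le0// sub0r normrN.
  rewrite ger0_norm ?kernel_primitive_ge0// ltr_pdivlMr// => /ltW.
  by [].
(* The absolute value of [eta] makes [S] meaningful on both sides of [0], since continuity under the
   integral is stated for a parameter in an open interval. The integrand at [eta = 0] dominates all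
   the others. *)
pose S (eta : R) := \int[@lebesgue_measure R]_(s in `]0, t[)
  (`|f s| / (t + `|eta| - s) `^ a).
have t0oo : `]0, t[ `<=` `[0, t] by exact: subset_itv_oo_cc.
have intft : (@lebesgue_measure R).-integrable `[0, t] (EFin \o f).
  exact: itv_integrableS (subset_itvcc (lexx 0) (ltW tb)) intf.
have iabs : (@lebesgue_measure R).-integrable `]0, t[
    (EFin \o (fun s => `|f s| / (t - s) `^ a)).
  apply: eq_itv_integrable (integrable_norm iD) => s _ /=.
  by rewrite normrM [`| _^-1|]ger0_norm ?invr_ge0 ?powR_ge0.
have iS (eta : R) : (@lebesgue_measure R).-integrable `]0, t[
    (EFin \o (fun s => `|f s| / (t + `|eta| - s) `^ a)).
  have [->|eta0] := eqVneq eta 0; first by rewrite normr0 addr0.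
  have H : (@lebesgue_measure R).-integrable `[0, t]
      (EFin \o (fun s => (t + `|eta| - s) `^ (- a) * `|f s|)).
    apply: integrable_continuousM; last exact: integrable_norm intft.
    apply: derivable_within_continuous => s /[!in_itv]/= /andP[_ st].
    have ts : 0 < t + `|eta| - s.
      have : 0 < `|eta| by rewrite normr_gt0.
      by move: st; lra.
    by have [] := is_derive1_subl (is_derive1_powR (- a) ts).
  apply: eq_itv_integrable (itv_integrableS t0oo H) => s _.
  by rewrite powRN mulrC.
have cS : {for 0, continuous S}.
  have I0 : (0 : R) \in `](-1)%R, (1 : R)[%classic by rewrite inE/= in_itv/= ltrN10 ltr01.
  apply: (@continuity_under_integral R _ _ (@lebesgue_measure R)
    (fun eta s => `|f s| / (t + `|eta| - s) `^ a) `]0, t[ (measurable_itv _)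
    (-1) 1 _ _ (fun s => `|f s| / (t - s) `^ a) iabs _ 0 I0).
  - by move=> eta _; exact: iS.
  - apply: aeW => s /= /[!in_itv]/= /andP[s0 st] eta _.
    have ts : 0 < t + `|eta| - s by rewrite addrAC ltr_wpDr// subr_gt0.
    have cpow : {for t + `|eta| - s, continuous (fun r => r `^ (- a))}.
      have [dp _] := is_derive1_powR (- a) ts.
      by apply: differentiable_continuous; exact/derivable1_diffP.
    have cin : {for eta, continuous (fun r : R => t + `|r| - s)}.
      apply: cvgB; last exact: cvg_cst.
      by apply: cvgD; [exact: cvg_cst|apply: cvg_norm; exact: cvg_id].
    have C : (t + `|r| - s) `^ (- a) @[r --> eta] --> (t + `|eta| - s) `^ (- a).
      exact: (continuous_comp cin cpow).
    rewrite [X in _ --> X]powRN in C.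
    apply: cvgMr; apply: cvg_trans C; apply: near_eq_cvg; near=> r.
    by rewrite /= powRN.
  - move=> eta _; apply: aeW => s /= /[!in_itv]/= /andP[s0 st].
    rewrite normrM normr_id [`| _^-1|]ger0_norm ?invr_ge0 ?powR_ge0//.
    rewrite ler_wpM2l// kernel_inv_le ?(ltW a0) ?subr_gt0//.
    by rewrite lerB// lerDl.
move: cS => /cvgrPdist_lt /(_ (e / 2)); rewrite divr_gt0// => /(_ isT)[d3 /= d30 HS].
exists (Num.min (Num.min d1 d2) (Num.min d3 (b - t))).
  by rewrite !lt_min d10 d20 d30 subr_gt0.
move=> eta /andP[eta0]; rewrite !lt_min => /andP[/andP[ed1 ed2] /andP[ed3 edb]].
have iK r : (@lebesgue_measure R).-integrable `[0, b]
    (EFin \o (fun s => kernel_primitive a (r - s) * f s)).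
  apply: integrable_continuousM => //; apply: continuous_subspaceT => x.
  exact: kernel_primitive_subl_continuous.
have te : t <= t + eta by rewrite lerDl ltW.
have teb : t + eta <= b by rewrite -lerBrDl ltW.
have iKte : (@lebesgue_measure R).-integrable `[0, t + eta]
    (EFin \o (fun s => kernel_primitive a (t + eta - s) * f s)).
  exact: itv_integrableS (subset_itvcc (lexx 0) teb) (iK _).
have iKoo r : (@lebesgue_measure R).-integrable `]0, t[
    (EFin \o (fun s => kernel_primitive a (r - s) * f s)).
  apply: itv_integrableS (iK r); apply: subset_trans t0oo _.
  exact: subset_itvcc (lexx 0) (ltW tb).
have E := @Rintegral_itvB R
  (fun s => kernel_primitive a (t + eta - s) * f s) (BLeft 0) (BRight (t + eta))
  t iKte.
move: E; rewrite !bnd_simp => /(_ (ltW t0) te) /eqP; rewrite subr_eq => /eqP ->.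
rewrite -2?Rintegral_cc_oo//.
rewrite -addrA -RintegralB//.
have B1 : \int[@lebesgue_measure R]_(s in `]t, t + eta])
    (kernel_primitive a (t + eta - s) * f s) <= eta * (e / 2).
  have -> : eta * (e / 2) = \int[@lebesgue_measure R]_(s in `]t, t + eta]) (e / 2).
    rewrite Rintegral_cst//= lebesgue_measure_itv/= lte_fin ltrDl eta0.
    by rewrite -EFinD/= addrAC subrr add0r mulrC.
  apply: le_Rintegral => //.
  - apply: itv_integrableS iKte; apply: subset_itvr.
    by rewrite bnd_simp ltW.
  - have : (@lebesgue_measure R).-integrable `[t, t + eta]
      (EFin \o (fun _ : R => e / 2)).
      apply: continuous_compact_integrable; first exact: segment_compact.
      by apply: continuous_subspaceT => x; exact: cvg_cst.
    by apply: itv_integrableS; apply: subset_itvr; rewrite bnd_simp.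
  - move=> s /= /[!in_itv]/= /andP[ts ste].
    apply: le_trans (Kbnd eta _); last by rewrite eta0.
    apply: (le_trans (ler_norm _)); rewrite normrM.
    rewrite [`|kernel_primitive _ _|]ger0_norm ?kernel_primitive_ge0//.
    apply: ler_pM => //; first exact: kernel_primitive_ge0.
      by apply: kernel_primitive_le => //; lra.
    by apply: fbnd; rewrite ltr0_norm ?subr_lt0//; lra.
have B2 : \int[@lebesgue_measure R]_(s in `]0, t[)
    (kernel_primitive a (t + eta - s) * f s - kernel_primitive a (t - s) * f s)
    <= eta * (\int[@lebesgue_measure R]_(s in `]0, t[) (f s / (t - s) `^ a) + e / 2).
  have S0 : S 0 - S eta <= e / 2.
    have := HS eta; rewrite /= sub0r normrN gtr0_norm// => /(_ ed3) /ltW.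
    by apply: le_trans; exact: ler_norm.
  apply: (@le_trans _ _ (eta *
    (\int[@lebesgue_measure R]_(s in `]0, t[) (f s / (t - s) `^ a)
     + (S 0 - S eta)))); last first.
    by rewrite ler_pM2l// lerD2l.
  have iSB := itv_integrableB (iS 0) (iS eta).
  have iSD := itv_integrableD iD iSB.
  have ES := @RintegralB _ _ _ (@lebesgue_measure R) _ _ _
    (measurable_itv _) (iS 0) (iS eta).
  have ED := @RintegralD _ _ _ (@lebesgue_measure R) _ _ _
    (measurable_itv _) iD iSB.
  have EZ := @RintegralZl _ _ _ (@lebesgue_measure R) _ _ eta
    (measurable_itv _) iSD.
  rewrite [leRHS](etrans (congr1 (fun z => eta * (_ + z)) (esym ES))
    (etrans (congr1 ( *%R eta) (esym ED)) (esym EZ))).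
  apply: le_Rintegral => //.
  - exact: (itv_integrableB (iKoo (t + eta)) (iKoo t)).
  - exact: (itv_integrableZl eta iSD).
  - move=> s /= /[!in_itv]/= /andP[s0 st].
    rewrite normr0 addr0 (gtr0_norm eta0).
    have ts : 0 < t - s by rewrite subr_gt0.
    have tse : t - s <= t + eta - s by rewrite lerD2r.
    have /andP[K1 K2] := kernel_primitive_increment a01 ts tse.
    have Eeta : t + eta - s - (t - s) = eta by ring.
    rewrite Eeta in K1 K2.
    set k0 := ((t - s) `^ a)^-1 in K2 *; set k1 := ((t + eta - s) `^ a)^-1 in K1 *.
    rewrite -mulrBl.
    (* For [f s >= 0] the upper bound [K2] suffices, the correction being nonnegative. For [f s < 0]
       the lower bound [K1] applies, and the correction replaces [k0] by [k1] exactly. *)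
    have [fs0|fs0] := leP 0 (f s).
      rewrite (ger0_norm fs0).
      have k10 : k1 <= k0 by apply: kernel_inv_le => //; exact: ltW.
      apply: (@le_trans _ _ (eta * k0 * f s)); first exact: ler_wpM2r.
      rewrite -mulrA ler_wpM2l ?(ltW eta0)// mulrC lerDl -mulrBr.
      by rewrite mulr_ge0// subr_ge0.
    rewrite (ltr0_norm fs0).
    apply: (@le_trans _ _ (eta * k1 * f s)); first by rewrite ler_wnM2r// ltW.
    by rewrite le_eqVlt; apply/orP; left; apply/eqP; ring.
by apply: le_trans (lerD B1 B2) _; rewrite -mulrDr addrCA -splitr.
Unshelve. all: end_near. Qed.

Lemma Rintegral_itvcc_restrict (R : realType) (a r b : R) (f : R -> R) :
  a <= r -> r <= b ->
  (@lebesgue_measure R).-integrable `[a, b] (EFin \o f) ->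
  (forall s, s \in `]r, b] -> f s = 0) ->
  \int[@lebesgue_measure R]_(s in `[a, b]) f s =
  \int[@lebesgue_measure R]_(s in `[a, r]) f s.
Proof.
move=> ar rb intf f0.
have := @Rintegral_itvB R f (BLeft a) (BRight b) r intf.
rewrite !bnd_simp => /(_ ar rb) /eqP.
rewrite subr_eq => /eqP ->.
rewrite (@eq_Rintegral _ _ _ _ _ (fun=> 0)); last first.
  by move=> s; rewrite inE/=; exact: f0.
by rewrite Rintegral_cst// mul0r add0r.
Qed.

(** As [kernel_primitive] vanishes to the left of [0], the integral over [[0, r]] equals the one
    over the fixed segment [[0, b]], where [kernel_primitive a b] times the absolute value of [f]
    dominates. *)
Lemma convolution_continuous (R : realType) (a b : R) (f : R -> R) :
  0 < a < 1 -> (@lebesgue_measure R).-integrable `[0, b] (EFin \o f) ->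
  forall t : R, t \in `]0, b[ -> {for t, continuous (fun r : R =>
    \int[@lebesgue_measure R]_(s in `[0, r]) (kernel_primitive a (r - s) * f s))}.
Proof.
move=> /andP[a0 a1] intf t tb.
have iK r : (@lebesgue_measure R).-integrable `[0, b]
    (EFin \o (fun s => kernel_primitive a (r - s) * f s)).
  apply: integrable_continuousM => //; apply: continuous_subspaceT => x.
  exact: kernel_primitive_subl_continuous.
pose P r := \int[@lebesgue_measure R]_(s in `[0, b]) (kernel_primitive a (r - s) * f s).
have iKb : (@lebesgue_measure R).-integrable `[0, b]
    (EFin \o (fun s => kernel_primitive a b * `|f s|)).
  exact: (itv_integrableZl _ (integrable_norm intf)).
have tb' : t \in `]0, b[%classic by rewrite inE.
have cP : {for t, continuous P}.
  apply: (@continuity_under_integral R _ _ (@lebesgue_measure R)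
    (fun r s => kernel_primitive a (r - s) * f s) `[0, b] (measurable_itv _)
    0 b _ _ (fun s => kernel_primitive a b * `|f s|) iKb _ t tb').
  - by move=> r _; exact: iK.
  - apply: aeW => s _ r _; apply: cvgMl.
    apply: (@continuous_comp R R R (fun x => x - s) (kernel_primitive a)).
      by apply: cvgB; [exact: cvg_id|exact: cvg_cst].
    exact: kernel_primitive_continuous.
  - move=> r /= /[!in_itv]/= /andP[r0 rb]; apply: aeW => s /= /[!in_itv]/= /andP[s0 sb].
    rewrite normrM ger0_norm ?kernel_primitive_ge0// ler_wpM2r//.
    by apply: kernel_primitive_le => //; lra.
have PE : {near t, P =1 (fun r : R => \int[@lebesgue_measure R]_(s in `[0, r])
    (kernel_primitive a (r - s) * f s))}.
  move: tb; rewrite in_itv/= => /andP[t0 tb].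
  near=> r; apply: Rintegral_itvcc_restrict.
  - by apply: ltW; near: r; exact: lt_nbhsr.
  - by apply: ltW; near: r; exact: lt_nbhsl.
  - exact: iK.
  - move=> s /[!in_itv]/= /andP[rs _].
    by rewrite kernel_primitive_le0 ?mul0r// subr_le0 ltW.
have C : P r @[r --> t] --> \int[@lebesgue_measure R]_(s in `[0, t])
    (kernel_primitive a (t - s) * f s).
  by rewrite -(nbhs_singleton PE).
by apply: cvg_trans C; apply: near_eq_cvg; exact: PE.
Unshelve. all: end_near. Qed.

Lemma integrable_of_caputo (R : realType) (a b : R) (f : R -> R) : 0 < a < 1 ->
  (@lebesgue_measure R).-integrable `]0, b[
    (EFin \o (fun s => f s / (b - s) `^ a)) ->
  (@lebesgue_measure R).-integrable `[0, b] (EFin \o f).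
Proof.
move=> /andP[a0 a1] iD; apply: integrable_cc_oo.
(* The factor [a * kernel_primitive (1 - a) (b - s)] is [(b - s) ^ a], in a form whose continuity up
   to [s = b] is already known; it cancels the kernel. *)
have H : (@lebesgue_measure R).-integrable `[0, b] (EFin \o
    (fun s => (a * kernel_primitive (1 - a) (b - s)) * (f s / (b - s) `^ a))).
  apply: integrable_continuousM; last exact: integrable_cc_oo.
  apply: continuous_subspaceT => x; apply: cvgMr.
  by apply: kernel_primitive_subl_continuous; rewrite gtrBl.
apply: eq_itv_integrable (itv_integrableS (@subset_itv_oo_cc _ _ _ _) H) => s.
rewrite in_itv/= => /andP[s0 sb].
rewrite /kernel_primitive leNgt subr_gt0 sb/=.
have -> : 1 - (1 - a) = a by ring.
have Pn0 : (b - s) `^ a != 0 by rewrite gt_eqF// powR_gt0// subr_gt0.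
by rewrite mulrC [a * _]mulrC !divfK// gt_eqF.
Qed.

(* The convolution with [kernel_primitive] is only known to have [D (g ^ 2)] as
   an upper right derivative, which is why the two sides are compared by
   [dini_nondecreasing]. *)
Lemma caputo_energy (R : realType) (a T ep tau : R) (g g' : R -> R) :
  0 < a < 1 -> 0 < ep -> ep <= tau -> tau < T ->
  {within `[0, T], continuous g} ->
  (forall p : R, p \in `]0, T[ -> is_derive p 1 g (g' p)) ->
  (forall p : R, p \in `]0, T[ -> {for p, continuous g'}) ->
  (forall t : R, t \in `]0, T[ -> (@lebesgue_measure R).-integrable `]0, t[
    (EFin \o (fun s => g' s / (t - s) `^ a))) ->
  (forall t : R, t \in `]0, T[ -> {for t, continuous (fun t : R =>
     \int[@lebesgue_measure R]_(s in `]0, t[) (g' s / (t - s) `^ a))}) ->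
  \int[@lebesgue_measure R]_(s in `[0, tau])
    (kernel_primitive a (tau - s) * (2 * g s * g' s)) -
  \int[@lebesgue_measure R]_(s in `[0, ep])
    (kernel_primitive a (ep - s) * (2 * g s * g' s)) <=
  \int[@lebesgue_measure R]_(t in `[ep, tau]) (2 * g t *
    \int[@lebesgue_measure R]_(s in `]0, t[) (g' s / (t - s) `^ a)).
Proof.
move=> a01 ep0 eptau tauT cg dg cg' iD cD.
have /andP[a0 a1] := a01.
(* A point strictly between [tau] and [T] leaves room for increments to the right of times up to
   [tau]. *)
pose b := (tau + T) / 2.
have taub : tau < b by rewrite /b; lra.
have bT : b < T by rewrite /b; lra.
have b0 : 0 < b by apply: lt_trans taub; exact: lt_le_trans eptau.
have b0T : b \in `]0, T[ by rewrite in_itv/= b0 bT.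
have cgt (t : R) : t \in `]0, T[ -> {for t, continuous g}.
  move=> tT; have [d _] := dg t tT.
  by apply: differentiable_continuous; exact/derivable1_diffP.
have cgb := continuous_subspaceW (subset_itvcc (lexx 0) (ltW bT)) cg.
have c2 (A : set R) : {within A, continuous (fun _ : R => 2 : R)}.
  by apply: continuous_subspaceT => x; exact: cvg_cst.
have ig' := integrable_of_caputo a01 (iD b b0T).
pose h' s := 2 * g s * g' s.
have c2g : {within `[0, b], continuous (fun s => 2 * g s)}.
  by apply: within_continuousM; [exact: c2|exact: cgb].
have ih' : (@lebesgue_measure R).-integrable `[0, b] (EFin \o h').
  exact: integrable_continuousM.
have ch' (t : R) : t \in `]0, T[ -> {for t, continuous h'}.
  move=> tT; apply: cvgM; last exact: cg'.
  by apply: cvgMr; exact: cgt.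
pose D t := \int[@lebesgue_measure R]_(s in `]0, t[) (g' s / (t - s) `^ a).
pose P t := \int[@lebesgue_measure R]_(s in `[0, t]) (kernel_primitive a (t - s) * h' s).
have cgD (t : R) : t \in `]0, T[ -> {for t, continuous (fun t : R => 2 * g t * D t)}.
  move=> tT; apply: cvgM; last exact: cD.
  by apply: cvgMr; exact: cgt.
(* Starting the primitive [A] before [ep] makes it differentiable at [ep] as well. *)
pose e1 := ep / 2.
have e10 : 0 < e1 by rewrite /e1; lra.
have e1ep : e1 < ep by rewrite /e1; lra.
have epb : ep < b by apply: le_lt_trans taub.
have igD : (@lebesgue_measure R).-integrable `[e1, b]
    (EFin \o (fun t => 2 * g t * D t)).
  apply: continuous_compact_integrable; first exact: segment_compact.
  apply: continuous_in_subspaceT => t /[!inE]/= /[!in_itv]/= /andP[et tb].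
  by apply: cgD; rewrite in_itv/= (lt_le_trans e10 et) (le_lt_trans tb).
pose A t := \int[@lebesgue_measure R]_(s in `[e1, t]) (2 * g s * D s).
have in0T t : ep <= t -> t <= tau -> t \in `]0, T[.
  by move=> et tt; rewrite in_itv/= (lt_le_trans ep0 et) (le_lt_trans tt).
have dA (t : R) : t \in `[ep, tau] -> is_derive t 1 A (2 * g t * D t).
  rewrite in_itv/= => /andP[et tt].
  apply: (primitive_is_derive _ _ igD).
  - exact: lt_le_trans e1ep et.
  - exact: le_lt_trans tt taub.
  - exact/cgD/in0T.
have AE : A tau - A ep = \int[@lebesgue_measure R]_(t in `[ep, tau]) (2 * g t * D t).
  have igDt : (@lebesgue_measure R).-integrable `[e1, tau]
      (EFin \o (fun t => 2 * g t * D t)).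
    exact: itv_integrableS (subset_itvcc (lexx _) (ltW taub)) igD.
  have := @Rintegral_itvB R (fun t => 2 * g t * D t) (BLeft e1) (BRight tau) ep
    igDt.
  rewrite !bnd_simp => /(_ (ltW e1ep) eptau) ->.
  rewrite Rintegral_itv_obnd_cbnd//.
  apply: itv_integrableS igDt; apply: subset_itvr.
  by rewrite bnd_simp ltW.
rewrite -/(P tau) -/(P ep) -/(D _) -AE.
have key (x y z w : R) : y - w <= x - z -> z - w <= x - y by lra.
apply: key.
(* The right increments of [P] are at most [eta * (2 * g t * D t + e / 2)] by [alikhanov], and those
   of [A] at least [eta * (2 * g t * D t - e / 2)]; together they lose only [eta * e]. *)
apply: (@dini_nondecreasing R (fun t => A t - P t) ep tau eptau).
  apply: continuous_in_subspaceT => t /[!inE]/= tt.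
  apply: cvgB.
    have [d _] := dA t tt.
    by apply: differentiable_continuous; exact/derivable1_diffP.
  apply: (convolution_continuous a01 ih').
  move: tt; rewrite !in_itv/= => /andP[et tt].
  by rewrite (lt_le_trans ep0 et) (le_lt_trans tt).
move=> t e /[!in_itv]/= /andP[et tt] e0.
have t0 := lt_le_trans ep0 et.
have tT := in0T t et (ltW tt).
have tb := lt_trans tt taub.
have tcc : t \in `[ep, tau] by rewrite in_itv/= et ltW.
have cgt' := continuous_subspaceW (subset_itvcc (lexx 0) (ltW tb)) cgb.
have iDt : (@lebesgue_measure R).-integrable `]0, t[
    (EFin \o (fun s => h' s / (t - s) `^ a)).
  have H : (@lebesgue_measure R).-integrable `[0, t]
      (EFin \o (fun s => 2 * g s * (g' s / (t - s) `^ a))).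
    apply: integrable_continuousM; last exact/integrable_cc_oo/iD.
    by apply: within_continuousM; [exact: c2|exact: cgt'].
  apply: eq_itv_integrable (itv_integrableS (@subset_itv_oo_cc _ _ _ _) H) => s _.
  by rewrite mulrA.
have e20 : 0 < e / 2 by rewrite divr_gt0.
have [d1 d10 H1] := convolution_right_increment a01 t0 tb ih' (ch' t tT) iDt e20.
have alik := alikhanov a01 t0 (lt_trans tb bT) cgt' dg cg' (iD t tT).
have [dAt AtE] := dA t tcc.
have [d2 d20 H2] : exists2 d2 : R, 0 < d2 & forall eta, 0 < eta < d2 ->
    eta * (2 * g t * D t - e / 2) <= A (t + eta) - A t.
  have : h^-1 *: (A (h *: (1 : R) + t) - A t) @[h --> 0^'] --> 'D_1 A t by exact: dAt.
  rewrite AtE => /cvgrPdist_lt /(_ _ e20)[d2 /= d20 H]; exists d2 => // eta /andP[eta0 etad].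
  have := H eta; rewrite /= sub0r normrN gtr0_norm// => /(_ etad).
  rewrite gt_eqF// => /(_ isT) /(le_lt_trans (ler_norm _)).
  rewrite /GRing.scale/= mulr1 [eta + t]addrC ltrBlDr -ltrBlDl => /ltW.
  by rewrite ler_pdivlMl.
exists (Num.min d1 d2); first by rewrite lt_min d10 d20.
move=> eta /andP[eta0]; rewrite lt_min => /andP[ed1 ed2].
have := H1 eta; rewrite eta0 ed1 => /(_ isT) {}H1.
have := H2 eta; rewrite eta0 ed2 => /(_ isT) {}H2.
have H3 : eta * (\int[@lebesgue_measure R]_(s in `]0, t[) (h' s / (t - s) `^ a) + e / 2)
    <= eta * (2 * g t * D t + e / 2).
  by rewrite ler_pM2l// lerD2r.
have {}H1 : P (t + eta) - P t <= eta * (2 * g t * D t + e / 2) := le_trans H1 H3.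
move: H1 H2; rewrite !mulrBr !mulrDr.
set x := A _; set y := A _; set z := P _; set w := P _; set u := eta * (_ * D t).
clear; lra.
Qed.

(** The convolution at [tau] is bounded below by [convolution_ge] and the one at [ep] above by
    [convolution_le], both with [h = g ^ 2]. The term [M * kernel_primitive a ep] is the price of
    starting at [ep], and it disappears as [ep] tends to [0]. *)
Lemma caputo_energy_ge (R : realType) (a T ep tau t1 t2 m M : R)
    (g g' : R -> R) :
  0 < a < 1 -> 0 < ep -> ep <= tau -> tau < T ->
  {within `[0, T], continuous g} ->
  (forall p : R, p \in `]0, T[ -> is_derive p 1 g (g' p)) ->
  (forall p : R, p \in `]0, T[ -> {for p, continuous g'}) ->
  (forall t : R, t \in `]0, T[ -> (@lebesgue_measure R).-integrable `]0, t[
    (EFin \o (fun s => g' s / (t - s) `^ a))) ->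
  (forall t : R, t \in `]0, T[ -> {for t, continuous (fun t : R =>
     \int[@lebesgue_measure R]_(s in `]0, t[) (g' s / (t - s) `^ a))}) ->
  g 0 = 0 -> (forall t : R, t \in `[0, T] -> g t ^+ 2 <= M) ->
  0 <= t1 -> t1 <= t2 -> t2 <= tau -> 0 <= m ->
  (forall t : R, t \in `]t1, t2[ -> m <= g t ^+ 2) ->
  (t2 - t1) * (m / tau `^ a) - M * kernel_primitive a ep <=
  \int[@lebesgue_measure R]_(t in `[ep, tau]) (2 * g t *
    \int[@lebesgue_measure R]_(s in `]0, t[) (g' s / (t - s) `^ a)).
Proof.
move=> a01 ep0 eptau tauT cg dg cg' iD cD g0 gM t10 t12 t2tau m0 gm.
apply: le_trans (caputo_energy a01 ep0 eptau tauT cg dg cg' iD cD).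
have tau0 := lt_le_trans ep0 eptau.
have cgt (t : R) : t \in `]0, T[ -> {for t, continuous g}.
  move=> tT; have [d _] := dg t tT.
  by apply: differentiable_continuous; exact/derivable1_diffP.
have ch (t : R) : t <= T -> {within `[0, t], continuous (fun s => g s ^+ 2)}.
  move=> tT; have cgs := continuous_subspaceW (subset_itvcc (lexx 0) tT) cg.
  exact: (within_continuousM cgs cgs).
have dh (t : R) : t <= T -> forall p : R, p \in `]0, t[ ->
    is_derive p 1 (fun s => g s ^+ 2) (2 * g p * g' p).
  move=> tT p pt; have D := is_deriveX 2 (dg p (in_itvoo_cc (lexx 0) tT pt)).
  by apply: (is_derive_eq D).
have ch' (t : R) : t <= T -> forall p : R, p \in `]0, t[ ->
    {for p, continuous (fun s => 2 * g s * g' s)}.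
  move=> tT p pt; have pT := in_itvoo_cc (lexx 0) tT pt.
  by apply: cvgM; [apply: cvgMr; exact: cgt|exact: cg'].
have ih' (t : R) : t \in `]0, T[ -> (@lebesgue_measure R).-integrable `[0, t]
    (EFin \o (fun s => 2 * g s * g' s)).
  move=> tT; have /andP[t0 tT'] : 0 < t < T by rewrite in_itv/= in tT.
  have cgs := continuous_subspaceW (subset_itvcc (lexx 0) (ltW tT')) cg.
  apply: integrable_continuousM; last exact: integrable_of_caputo a01 (iD t tT).
  apply: within_continuousM; last exact: cgs.
  by apply: continuous_subspaceT => x; exact: cvg_cst.
have h0 : g 0 ^+ 2 = 0 by rewrite g0 expr0n.
have epT := le_lt_trans eptau tauT.
have epI : ep \in `]0, T[ by rewrite in_itv/= ep0.
have tauI : tau \in `]0, T[ by rewrite in_itv/= tau0.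
have gge0 (p : R) : p \in `[0, tau] -> 0 <= g p ^+ 2 by rewrite sqr_ge0.
have gMep (p : R) : p \in `[0, ep] -> g p ^+ 2 <= M.
  by move=> /(subset_itvcc (lexx 0) (ltW epT)); exact: gM.
have LtauT := ltW tauT.
have LepT := ltW epT.
apply: lerB.
- exact: (convolution_ge a01 tau0 (ch tau LtauT) (dh tau LtauT) (ch' tau LtauT)
    (ih' tau tauI) h0 t10 t12 t2tau gge0 m0 gm).
- exact: (convolution_le a01 ep0 (ch ep LepT) (dh ep LepT) (ch' ep LepT)
    (ih' ep epI) h0 gMep).
Qed.

(** * Functions continuous up to the vertex *)

Lemma continuous_onP (R : realType) (b I : set R) (g : R -> R -> R) :
  continuous_on b I g <-> forall x t, b x -> I t ->
    g p.1 p.2 @[p --> within (b `*` I) (nbhs (x, t))] --> g x t.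
Proof.
rewrite /continuous_on; split => [/subspace_continuousP H x t bx It|H].
  exact: (H (x, t)).
by apply/subspace_continuousP => -[x t] [bx It]; exact: H.
Qed.

Lemma continuous_onS (R : realType) (b I b' I' : set R) (g : R -> R -> R) :
  b' `<=` b -> I' `<=` I -> continuous_on b I g -> continuous_on b' I' g.
Proof. by move=> bb' II'; apply: continuous_subspaceW => -[x t] [/bb' ? /II']. Qed.

Lemma eq_continuous_on (R : realType) (b I : set R) (g h : R -> R -> R) :
  (forall x t, b x -> I t -> g x t = h x t) ->
  continuous_on b I g -> continuous_on b I h.
Proof.
move=> gh; apply: subspace_eq_continuous => -[x t] /[!inE] -[bx It].
exact: gh.
Qed.

Lemma continuous_onM (R : realType) (b I : set R) (g h : R -> R -> R) :
  continuous_on b I g -> continuous_on b I h ->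
  continuous_on b I (fun x t => g x t * h x t).
Proof. exact: within_continuousM. Qed.

Lemma continuous_onB (R : realType) (b I : set R) (g h : R -> R -> R) :
  continuous_on b I g -> continuous_on b I h ->
  continuous_on b I (fun x t => g x t - h x t).
Proof. exact: within_continuousB. Qed.

Lemma continuous_on_cst (R : realType) (b I : set R) (c : R) :
  continuous_on b I (fun _ _ => c).
Proof. by apply: continuous_subspaceT => x; exact: cvg_cst. Qed.

Lemma within_setX_cvg (R : realType) (b I : set R) (T : Type)
    (F : set_system T) (FF : Filter F) (f1 f2 : T -> R) (x t : R) :
  f1 @ F --> x -> f2 @ F --> t -> (\forall y \near F, b (f1 y) /\ I (f2 y)) ->
  (f1 y, f2 y) @[y --> F] --> within (b `*` I) (nbhs (x, t)).
Proof.
move=> f1x f2t bI V VbI.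
have H : (f1 y, f2 y) @[y --> F] --> (x, t) by exact: cvg_pair f1x f2t.
by apply: filterS2 (H _ VbI) bI => y /= Hy; exact: Hy.
Qed.

Lemma continuous_on_slice (R : realType) (b I : set R) (g : R -> R -> R) x :
  continuous_on b I g -> b x -> {within I, continuous (g x)}.
Proof.
move=> /continuous_onP cg bx; apply/subspace_continuousP => t It.
have H : (x, s) @[s --> within I (nbhs t)] --> within (b `*` I) (nbhs (x, t)).
  apply: within_setX_cvg; [exact: cvg_cst|exact: cvg_within|].
  by apply: filterS (withinT I (nbhs_filter t)).
exact: (cvg_comp _ _ H (cg x t bx It)).
Qed.

Lemma continuous_on_slicex (R : realType) (b I : set R) (g : R -> R -> R) t :
  continuous_on b I g -> I t -> {within b, continuous (g ^~ t)}.
Proof.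
move=> /continuous_onP cg It; apply/subspace_continuousP => x bx.
have H : (y, t) @[y --> within b (nbhs x)] --> within (b `*` I) (nbhs (x, t)).
  apply: within_setX_cvg; [exact: cvg_within|exact: cvg_cst|].
  by apply: filterS (withinT b (nbhs_filter x)).
exact: (cvg_comp _ _ H (cg x t bx It)).
Qed.

Lemma continuous_on_bounded (R : realType) (b I A K : set R) (g : R -> R -> R) :
  continuous_on b I g -> compact A -> A `<=` b -> compact K -> K `<=` I ->
  exists2 M : R, 0 < M & forall x t, A x -> K t -> `|g x t| <= M.
Proof.
move=> cg cA Ab cK KI.
have := continuous_compact (continuous_onS Ab KI cg) (compact_setX cA cK).
move=> /compact_bounded[M [_ HM]]; exists (`|M| + 1).
  by rewrite ltr_wpDl.
move=> x t Ax Kt; apply: (HM (`|M| + 1)).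
  by rewrite (le_lt_trans (ler_norm _))// ltrDl.
by exists (x, t).
Qed.

Lemma continuous_on_slice_at (R : realType) (b I : set R) (g : R -> R -> R) x t :
  continuous_on b I g -> b x -> I° t -> {for t, continuous (g x)}.
Proof.
move=> cg bx It.
have /subspace_continuousP/(_ t (interior_subset It)) := continuous_on_slice cg bx.
by rewrite within_interior.
Qed.

(* [clip] retracts the line onto the closed edge, so that the parameter of the
   integral ranges over a neighbourhood of the vertex. *)
Lemma Rintegral_vertex_cvg (R : realType) (b : set R) (clip : R -> R) (tau : R)
    (F : R -> R -> R) :
  continuous clip -> (forall x, closure b (clip x)) ->
  (forall x, b x -> clip x = x) -> clip 0 = 0 -> 0 <= tau ->
  continuous_on (closure b) `[0, tau] F ->
  \int[@lebesgue_measure R]_(t in `[0, tau]) F x t @[x --> within b (nbhs 0)]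
  --> \int[@lebesgue_measure R]_(t in `[0, tau]) F 0 t.
Proof.
move=> cclip clipb clipE clip0 tau0 cF.
pose f x t := F (clip x) t.
have cf : continuous_on setT `[0, tau] f.
  apply/continuous_onP => x t _ It.
  have /continuous_onP/(_ (clip x) t (clipb x) It) := cF.
  apply: (@cvg_comp _ _ _ (fun p : R * R => (clip p.1, p.2))
    (fun p : R * R => F p.1 p.2)).
  apply: within_setX_cvg.
  - have C : clip p.1 @[p --> (x, t)] --> clip x.
      exact: (@cvg_comp _ _ _ fst clip _ (nbhs x) _ cvg_fst (cclip x)).
    exact: cvg_within_filter C.
  - have C : p.2 @[p --> (x, t)] --> t by exact: cvg_snd.
    exact: cvg_within_filter C.
  - apply: filterS (withinT (setT `*` `[0, tau]) (nbhs_filter (x, t))).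
    by move=> -[y s] [_ Is].
have [M M0 Mf] := continuous_on_bounded cf (@segment_compact R (-1) 1)
  (@subsetT _ _) (@segment_compact R 0 tau) (@subset_refl _ _).
have I0 : (0 : R) \in `](-1)%R, (1 : R)[%classic.
  by rewrite inE/= in_itv/= ltrN10 ltr01.
have ccst (c : R) : (@lebesgue_measure R).-integrable `[0, tau] (EFin \o (fun=> c)).
  apply: continuous_compact_integrable; first exact: segment_compact.
  by apply: continuous_subspaceT => x; exact: cvg_cst.
have cG : {for (0 : R), continuous
    (fun x : R => \int[@lebesgue_measure R]_(t in `[0, tau]) f x t)}.
  apply: (@continuity_under_integral R _ _ (@lebesgue_measure R)
    f `[0, tau] (measurable_itv _) (-1) 1 _ _ (fun=> M) (ccst M) _ 0 I0).
  - move=> x _; apply: continuous_compact_integrable; first exact: segment_compact.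
    exact: continuous_on_slice cf _.
  - apply: aeW => t It x _.
    have /subspace_continuousP/(_ x) := continuous_on_slicex cf It.
    by rewrite within_interior; [apply|rewrite interiorT].
  - move=> x Ix; apply: aeW => t It; apply: Mf => //.
    exact: subset_itv_oo_cc.
have E : \int[@lebesgue_measure R]_(t in `[0, tau]) f 0 t =
    \int[@lebesgue_measure R]_(t in `[0, tau]) F 0 t.
  by apply: eq_Rintegral => t _; rewrite /f clip0.
have : (fun x => \int[@lebesgue_measure R]_(t in `[0, tau]) f x t) x
    @[x --> within b (nbhs 0)] --> \int[@lebesgue_measure R]_(t in `[0, tau]) F 0 t.
  have : (fun x => \int[@lebesgue_measure R]_(t in `[0, tau]) f x t) x
    @[x --> nbhs 0] --> \int[@lebesgue_measure R]_(t in `[0, tau]) F 0 t.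
    by have := cG; rewrite /prop_for /continuous_at E.
  exact: cvg_within_filter.
move=> C; apply: cvg_trans C; apply: near_eq_cvg.
apply: filterS (withinT b (nbhs_filter (0 : R))) => x bx.
by rewrite /f clipE.
Unshelve. all: end_near. Qed.

(** * Flux along an edge *)

(* [W j] stands for the [j]-th derivative in [x] of a difference of two
   solutions on the edge [b], [Wt] for its derivative in time, [V j] for the
   value of [W j] at the vertex and [gam] for [Gamma (1 - a)]. *)
Record homogeneous_edge (R : realType) (b : set R) (a T gam : R)
    (W : nat -> R -> R -> R) (Wt : R -> R -> R) (V : nat -> R -> R) : Prop :=
  HomogeneousEdge {
  he_dx : forall (j : nat) (x t : R), (j < 2)%N -> b x -> t \in `[0, T] ->
    is_derive x 1 (W j ^~ t) (W j.+1 x t);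
  he_dxxx : forall x t : R, b x -> t \in `]0, T] ->
    is_derive x 1 (W 2 ^~ t) (W 3 x t);
  he_ext : forall j : nat, (j <= 2)%N -> exists h : R -> R -> R,
    [/\ continuous_on (closure b) `[0, T] h,
        forall x t, b x -> t \in `[0, T] -> h x t = W j x t &
        forall t, t \in `[0, T] -> h 0 t = V j t];
  he_cxxx : continuous_on b `]0, T] (W 3);
  he_dt : forall x t : R, b x -> t \in `]0, T[ ->
    is_derive t 1 (W 0 x) (Wt x t);
  he_ct : continuous_on b `]0, T[ Wt;
  he_int : forall x t : R, b x -> t \in `]0, T] ->
    (@lebesgue_measure R).-integrable `]0, t[
      (EFin \o (fun s => Wt x s / (t - s) `^ a));
  he_eq : forall x t : R, b x -> t \in `]0, T] ->
    \int[@lebesgue_measure R]_(s in `]0, t[) (Wt x s / (t - s) `^ a) =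
    gam * W 3 x t;
  he_init : forall x : R, b x -> W 0 x 0 = 0;
  he_vanish : forall j : nat, (j <= 2)%N ->
    vanishes_at_infinity b `[0, T] (W j)
}.

Definition edge_flux (R : realType) (W : nat -> R -> R -> R) (x t : R) : R :=
  W 0 x t * W 2 x t - W 1 x t * W 1 x t / 2.

Section homogeneous_edge_theory.
Context (R : realType) (b : set R) (a T gam : R).
Context (W : nat -> R -> R -> R) (Wt : R -> R -> R) (V : nat -> R -> R).
Context (a01 : 0 < a < 1) (ob : open b) (gam0 : 0 < gam).
Context (he : homogeneous_edge b a T gam W Wt V).

Let cW (j : nat) : (j <= 2)%N -> continuous_on b `[0, T] (W j).
Proof.
move=> j2; have [h [ch hW _]] := he_ext he j2.
apply: (@eq_continuous_on _ _ _ h) => //.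
exact: continuous_onS (@subset_closure _ b) (@subset_refl _ _) ch.
Qed.

Lemma edge_flux_continuous : continuous_on b `[0, T] (edge_flux W).
Proof.
apply: continuous_onB; first by apply: continuous_onM; exact: cW.
apply: continuous_onM; last exact: continuous_on_cst.
by apply: continuous_onM; exact: cW.
Qed.

Lemma edge_flux_integrable (x s t : R) : b x -> 0 <= s -> t <= T ->
  (@lebesgue_measure R).-integrable `[s, t] (EFin \o edge_flux W x).
Proof.
move=> bx s0 tT; apply: continuous_compact_integrable; first exact: segment_compact.
apply: continuous_on_slice bx.
exact: continuous_onS (@subset_refl _ _) (subset_itvcc s0 tT) edge_flux_continuous.
Qed.

Let dflux (x t : R) : b x -> t \in `]0, T] ->
  is_derive x 1 (edge_flux W ^~ t) (W 0 x t * W 3 x t).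
Proof.
move=> bx tT.
have tT' : t \in `[0, T] by move: tT; rewrite !in_itv/= => /andP[/ltW -> ->].
have d0 := he_dx he (isT : (0 < 2)%N) bx tT'.
have d1 := he_dx he (isT : (1 < 2)%N) bx tT'.
have d2 := he_dxxx he bx tT.
have D := is_deriveB (is_deriveM d0 d2)
  (is_deriveM (is_deriveM d1 d1) (is_derive_cst (2^-1 : R) x 1)).
apply: (is_derive_eq D).
by rewrite /GRing.scale/= mulr0 add0r; field.
Qed.

(** Differentiation under the integral sign. Times are kept above [ep > 0] because [W 3] is
    continuous, hence bounded on compact sets, on []0, T]] only. *)
Lemma edge_flux_is_derive (x ep tau : R) : b x -> 0 < ep -> tau <= T ->
  is_derive x 1
    (fun y => \int[@lebesgue_measure R]_(t in `[ep, tau]) edge_flux W y t)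
    (\int[@lebesgue_measure R]_(t in `[ep, tau]) (W 0 x t * W 3 x t)).
Proof.
move=> bx ep0 tauT.
have [r r0 xrb] : exists2 r : R, 0 < r & `[x - r, x + r] `<=` b.
  have /nbhs_ballP[r /= r0 xrb] := ob bx.
  exists (r / 2); first by rewrite divr_gt0.
  move=> y /= /[!in_itv]/= /andP[xy yx]; apply: xrb; rewrite /ball/=.
  rewrite ltr_norml; lra.
have subI : `[ep, tau] `<=` `]0, T].
  move=> t /= /[!in_itv]/= /andP[et tt].
  by rewrite (lt_le_trans ep0 et) (le_trans tt).
have subT : `]0, T] `<=` `[0, T].
  by move=> t /= /[!in_itv]/= /andP[/ltW -> ->].
have cW03 : continuous_on b `]0, T] (fun x t => W 0 x t * W 3 x t).
  apply: continuous_onM; last exact: he_cxxx he.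
  exact: continuous_onS (@subset_refl _ _) subT (cW (isT : (0 <= 2)%N)).
have [M M0 HM] := continuous_on_bounded cW03 (@segment_compact R (x - r) (x + r))
  xrb (@segment_compact R ep tau) subI.
have ccst (c : R) : (@lebesgue_measure R).-integrable `[ep, tau] (EFin \o (fun=> c)).
  apply: continuous_compact_integrable; first exact: segment_compact.
  by apply: continuous_subspaceT => y; exact: cvg_cst.
have Ix : `]x - r, x + r[%classic x by rewrite /= in_itv/=; apply/andP; split; lra.
have Ib (y : R) : `]x - r, x + r[%classic y -> b y.
  by move=> /subset_itv_oo_cc; exact: xrb.
have intf (y : R) : `]x - r, x + r[%classic y ->
    (@lebesgue_measure R).-integrable `[ep, tau] (EFin \o edge_flux W y).
  by move=> /Ib yb; exact: edge_flux_integrable yb (ltW ep0) tauT.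
have derf (y t : R) : `]x - r, x + r[%classic y -> `[ep, tau]%classic t ->
    derivable (edge_flux W ^~ t) y 1.
  by move=> /Ib yb /subI tI; have [] := dflux yb tI.
have partialE (y t : R) : b y -> `[ep, tau]%classic t ->
    partial1of2 (edge_flux W) y t = W 0 y t * W 3 y t.
  by move=> yb /subI tI; rewrite /partial1of2 derive1E; have [] := dflux yb tI.
have bnd (y t : R) : `]x - r, x + r[%classic y -> `[ep, tau]%classic t ->
    `|partial1of2 (edge_flux W) y t| <= M.
  move=> Iy tI; rewrite partialE//; last exact: Ib.
  by apply: HM => //; exact: subset_itv_oo_cc.
have G0 (t : R) : 0 <= M by rewrite ltW.
have D1 := @derivable_under_integral R _ _ (@lebesgue_measure R) (edge_flux W)
  `[ep, tau] (measurable_itv _) x _ _ Ix intf derf (fun=> M) G0 (ccst M) bnd.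
have D2 := @differentiation_under_integral R _ _ (@lebesgue_measure R) (edge_flux W)
  `[ep, tau] (measurable_itv _) x _ _ Ix intf derf (fun=> M) G0 (ccst M) bnd.
apply: DeriveDef; first exact: D1.
rewrite -derive1E D2; apply: eq_Rintegral => t /[!inE] tI.
exact: partialE.
Qed.

(** Mean value theorem in [x]: the slope is the time integral of [W 0 * W 3], which the equation
    turns into the quantity bounded by [caputo_energy_ge]. The divisor [2 * gam] collects the [2] of
    the energy inequality and the Gamma factor of the equation. *)
Lemma edge_increment_pos_time (c d ep tau t1 t2 m M : R) : c <= d ->
  `[c, d] `<=` b -> 0 < ep -> ep <= tau -> tau < T ->
  (forall x t : R, `[c, d]%classic x -> t \in `[0, T] -> W 0 x t ^+ 2 <= M) ->
  0 <= t1 -> t1 <= t2 -> t2 <= tau -> 0 <= m ->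
  (forall x t : R, `[c, d]%classic x -> t \in `]t1, t2[ -> m <= W 0 x t ^+ 2) ->
  (d - c) * (((t2 - t1) * (m / tau `^ a) - M * kernel_primitive a ep) / (2 * gam))
  <= \int[@lebesgue_measure R]_(t in `[ep, tau]) edge_flux W d t -
     \int[@lebesgue_measure R]_(t in `[ep, tau]) edge_flux W c t.
Proof.
move=> cd cdb ep0 eptau tauT hM t10 t12 t2tau m0 hm.
have dG (x : R) : b x -> is_derive x 1
    (fun y => \int[@lebesgue_measure R]_(t in `[ep, tau]) edge_flux W y t)
    (\int[@lebesgue_measure R]_(t in `[ep, tau]) (W 0 x t * W 3 x t)).
  by move=> bx; exact: edge_flux_is_derive bx ep0 (ltW tauT).
have oob (x : R) : x \in `]c, d[ -> b x.
  by move=> xcd; apply: cdb; exact: subset_itv_oo_cc.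
have dGoo (x : R) (xcd : x \in `]c, d[) := dG x (oob x xcd).
have cG : {within `[c, d], continuous
    (fun y => \int[@lebesgue_measure R]_(t in `[ep, tau]) edge_flux W y t)}.
  by apply: derivable_within_continuous => x xcd; have [] := dG x (cdb x xcd).
apply: (mvt_ge cd dGoo cG) => x xcd.
have bx := oob x xcd; have xcc := subset_itv_oo_cc xcd.
have ooc (t : R) : t \in `]0, T[ -> t \in `]0, T].
  by rewrite !in_itv/= => /andP[-> /ltW ->].
have cg := continuous_on_slice (cW (isT : (0 <= 2)%N)) bx.
have cg' (t : R) : t \in `]0, T[ -> {for t, continuous (Wt x)}.
  move=> tT; apply: (continuous_on_slice_at (he_ct he) bx).
  exact: near_in_itvoo tT.
have dg (t : R) (tT : t \in `]0, T[) := he_dt he bx tT.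
have iD (t : R) (tT : t \in `]0, T[) := he_int he bx (ooc t tT).
(* Continuity in time of the singular integral is read off the equation, as it equals
   [gam * W 3 x]. *)
have cD (t : R) : t \in `]0, T[ -> {for t, continuous (fun t : R =>
     \int[@lebesgue_measure R]_(s in `]0, t[) (Wt x s / (t - s) `^ a))}.
  move=> tT.
  have nT : {near t, (fun t => gam * W 3 x t) =1 (fun t : R =>
     \int[@lebesgue_measure R]_(s in `]0, t[) (Wt x s / (t - s) `^ a))}.
    near=> s; apply/esym/(he_eq he bx); apply: ooc.
    by near: s; exact: near_in_itvoo.
  have C : gam * W 3 x s @[s --> t] --> gam * W 3 x t.
    apply: cvgMr; apply: (continuous_on_slice_at (he_cxxx he) bx).
    by apply: filterS (near_in_itvoo tT) => s; exact: ooc.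
  have Et := nbhs_singleton nT; rewrite /= in Et.
  rewrite Et in C.
  by apply: cvg_trans C; apply: near_eq_cvg.
have gM (t : R) : t \in `[0, T] -> W 0 x t ^+ 2 <= M by exact: hM.
have gm (t : R) : t \in `]t1, t2[ -> m <= W 0 x t ^+ 2 by exact: hm.
have := caputo_energy_ge a01 ep0 eptau tauT cg dg cg' iD cD
  (he_init he bx) gM t10 t12 t2tau m0 gm.
have g2 : 0 < 2 * gam by rewrite mulr_gt0.
rewrite ler_pdivrMr// => /le_trans; apply.
have iW : (@lebesgue_measure R).-integrable `[ep, tau]
    (EFin \o (fun t => W 0 x t * W 3 x t)).
  apply: continuous_compact_integrable; first exact: segment_compact.
  have subI : `[ep, tau] `<=` `]0, T].
    move=> t /= /[!in_itv]/= /andP[et tt].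
    by rewrite (lt_le_trans ep0 et) (le_trans tt (ltW tauT)).
  have subT : `[ep, tau] `<=` `[0, T] by exact: subset_itvcc (ltW ep0) (ltW tauT).
  apply: within_continuousM; first exact: continuous_subspaceW subT cg.
  apply: continuous_subspaceW subI _; exact: continuous_on_slice (he_cxxx he) bx.
have EZ := @RintegralZl _ _ _ (@lebesgue_measure R) _ _ (2 * gam)
    (measurable_itv _) iW.
rewrite [leRHS]mulrC -EZ le_eqVlt; apply/orP; left; apply/eqP.
apply: eq_Rintegral => t /[!inE]/= /[!in_itv]/= /andP[et tt].
rewrite (he_eq he)//; first by ring.
by rewrite in_itv/= (lt_le_trans ep0 et) (le_trans tt (ltW tauT)).
Unshelve. all: end_near. Qed.

(** Limit [ep] to [0] in the preceding estimate. The flux contains derivatives in [x] of order at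
    most two, which are continuous down to [t = 0], so its integrals over [[0, ep]] vanish in the
    limit along with [kernel_primitive a ep]. *)
Lemma edge_increment (c d tau t1 t2 m : R) : c <= d ->
  `[c, d] `<=` b -> 0 < tau -> tau < T ->
  0 <= t1 -> t1 <= t2 -> t2 <= tau -> 0 <= m ->
  (forall x t : R, `[c, d]%classic x -> t \in `]t1, t2[ -> m <= W 0 x t ^+ 2) ->
  (d - c) * ((t2 - t1) * (m / tau `^ a) / (2 * gam))
  <= \int[@lebesgue_measure R]_(t in `[0, tau]) edge_flux W d t -
     \int[@lebesgue_measure R]_(t in `[0, tau]) edge_flux W c t.
Proof.
move=> cd cdb tau0 tauT t10 t12 t2tau m0 hm.
have [_ a1] := andP a01.
have [M M0 HM] := continuous_on_bounded (cW (isT : (0 <= 2)%N))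
  (@segment_compact R c d) cdb (@segment_compact R 0 T) (@subset_refl _ _).
have HM2 (x t : R) : `[c, d]%classic x -> t \in `[0, T] -> W 0 x t ^+ 2 <= M ^+ 2.
  move=> xcd tT; rewrite -[leLHS]real_normK ?num_real// lerXn2r ?nnegrE ?(ltW M0)//.
  exact: HM.
have iF (x : R) : `[c, d]%classic x ->
    (@lebesgue_measure R).-integrable `[0, tau] (EFin \o edge_flux W x).
  by move=> /cdb bx; exact: edge_flux_integrable bx (lexx 0) (ltW tauT).
have split_int (x ep : R) : `[c, d]%classic x -> 0 < ep -> ep <= tau ->
    \int[@lebesgue_measure R]_(t in `[ep, tau]) edge_flux W x t =
    \int[@lebesgue_measure R]_(t in `[0, tau]) edge_flux W x t -
    \int[@lebesgue_measure R]_(t in `[0, ep]) edge_flux W x t.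
  move=> xcd ep0 eptau.
  have := @Rintegral_itvB R (edge_flux W x) (BLeft 0) (BRight tau) ep (iF x xcd).
  rewrite !bnd_simp => /(_ (ltW ep0) eptau) ->.
  rewrite Rintegral_itv_obnd_cbnd//.
  apply: itv_integrableS (iF x xcd); apply: subset_itvr.
  by rewrite bnd_simp ltW.
have ccd : `[c, d]%classic c by rewrite /= in_itv/= lexx.
have dcd : `[c, d]%classic d by rewrite /= in_itv/= lexx andbT.
pose I0 (x ep : R) := \int[@lebesgue_measure R]_(t in `[0, ep]) edge_flux W x t.
have I0_cvg (x : R) : `[c, d]%classic x -> I0 x ep @[ep --> 0^'+] --> 0.
  move=> xcd; have C := parameterized_integral_cvg_left tau0 (iF x xcd).
  exact: cvg_within_filter C.
have K_cvg : kernel_primitive a ep @[ep --> 0^'+] --> 0.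
  have C := @kernel_primitive_continuous R a a1 0.
  rewrite /continuous_at [kernel_primitive a 0]kernel_primitive_le0// in C.
  exact: cvg_within_filter C.
rewrite -subr_ge0.
have C : (I0 d tau - I0 d ep) - (I0 c tau - I0 c ep) -
    (d - c) * (((t2 - t1) * (m / tau `^ a) - M ^+ 2 * kernel_primitive a ep) / (2 * gam))
    @[ep --> 0^'+] -->
    (I0 d tau - 0) - (I0 c tau - 0) -
    (d - c) * (((t2 - t1) * (m / tau `^ a) - M ^+ 2 * 0) / (2 * gam)).
  apply: cvgB.
    by apply: cvgB; apply: cvgB; [exact: cvg_cst|exact: I0_cvg|exact: cvg_cst|exact: I0_cvg].
  apply: cvgMr; apply: cvgMl; apply: cvgB; first exact: cvg_cst.
  by apply: cvgMr.
rewrite !subr0 mulr0 subr0 in C.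
apply: (cvgr_to_ge C); near=> ep.
have ep0 : 0 < ep by near: ep; exact: nbhs_right_gt.
have eptau : ep <= tau by near: ep; exact: nbhs_right_le.
have H := edge_increment_pos_time cd cdb ep0 eptau tauT HM2 t10 t12 t2tau m0 hm.
rewrite (split_int d ep dcd ep0 eptau) (split_int c ep ccd ep0 eptau) in H.
by rewrite subr_ge0; exact: H.
Unshelve. all: end_near. Qed.

Lemma edge_mono (c d tau : R) : c <= d -> `[c, d] `<=` b -> 0 < tau -> tau < T ->
  \int[@lebesgue_measure R]_(t in `[0, tau]) edge_flux W c t <=
  \int[@lebesgue_measure R]_(t in `[0, tau]) edge_flux W d t.
Proof.
move=> cd cdb tau0 tauT.
(* An empty time window with [m = 0] keeps only the sign. *)
have := @edge_increment c d tau 0 0 0 cd cdb tau0 tauT (lexx 0) (lexx 0)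
  (ltW tau0) (lexx 0).
rewrite !mul0r subrr !mul0r mulr0 subr_ge0; apply => x t _ _.
exact: sqr_ge0.
Qed.

(** If [W 0] were nonzero at a point with [0 < t < T], its square would exceed some [m > 0] on the
    rectangle of the points of [[x, x + e]] at times in []t - e', t[]. With [tau = t],
    [edge_increment] would then make the time integral of the flux grow strictly from [x] to
    [x + e], although it is [0] at both. *)
Lemma edge_eq0 : 0 < T ->
  (forall tau x : R, 0 < tau -> tau < T -> b x ->
    \int[@lebesgue_measure R]_(t in `[0, tau]) edge_flux W x t = 0) ->
  forall x t : R, b x -> t \in `[0, T] -> W 0 x t = 0.
Proof.
move=> T0 G0.
have oo (x t : R) : b x -> t \in `]0, T[ -> W 0 x t = 0.
  move=> bx tT; apply/eqP/negPn/negP => W0.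
  have /andP[t0 tT'] : 0 < t < T by rewrite in_itv/= in tT.
  pose m := W 0 x t ^+ 2 / 2.
  have sq0 : 0 < W 0 x t ^+ 2 by rewrite lt_neqAle sqr_ge0 eq_sym sqrf_eq0 W0.
  have m0 : 0 < m by rewrite divr_gt0.
  have cc (s : R) : s \in `]0, T[ -> s \in `[0, T] by exact: subset_itv_oo_cc.
  have C : {for (x, t), continuous (fun p : R * R => W 0 p.1 p.2 * W 0 p.1 p.2)}.
    have := continuous_onM (cW (isT : (0 <= 2)%N)) (cW (isT : (0 <= 2)%N)).
    move=> /continuous_onP/(_ x t bx (cc t tT)).
    rewrite within_interior//.
    exists (b, `]0, T[%classic); first by split; [exact: ob|exact: near_in_itvoo].
    by move=> [y s] [/= yb sT]; split => //; exact: cc.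
  have /cvgrPdist_lt/(_ _ m0)[[A B] [/= /nbhs_ballP[r /= r0 Ar]
    /nbhs_ballP[r' /= r'0 Br']] AB] := C.
  have /nbhs_ballP[r2 /= r20 br2] := ob bx.
  have W_ge (y s : R) : `|x - y| < r -> `|t - s| < r' -> m <= W 0 y s ^+ 2.
    move=> xy ts; have := AB (y, s) (conj (Ar _ xy) (Br' _ ts)).
    rewrite /= -!expr2 => /(le_lt_trans (ler_norm _)).
    rewrite /m; lra.
  pose e := Num.min (r / 2) (r2 / 2).
  have e0 : 0 < e by rewrite lt_min !divr_gt0.
  have er : e < r by rewrite gt_min ltr_pdivrMr// ltr_pMr// ltr1n.
  have er2 : e < r2 by rewrite gt_min orbC ltr_pdivrMr// ltr_pMr// ltr1n.
  pose e' := Num.min (r' / 2) (t / 2).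
  have e'0 : 0 < e' by rewrite lt_min !divr_gt0.
  have e'r : e' < r' by rewrite gt_min ltr_pdivrMr// ltr_pMr// ltr1n.
  have e't : e' < t by rewrite gt_min orbC ltr_pdivrMr// ltr_pMr// ltr1n.
  have xe : x <= x + e by rewrite lerDl ltW.
  have sub : `[x, x + e] `<=` b.
    move=> y /= /[!in_itv]/= /andP[xy ye]; apply: br2; rewrite /ball/= ler0_norm; lra.
  have te : 0 <= t - e' by rewrite subr_ge0 ltW.
  have tet : t - e' <= t by rewrite gerBl ltW.
  have hm (y s : R) : `[x, x + e]%classic y -> s \in `]t - e', t[ -> m <= W 0 y s ^+ 2.
    rewrite /= !in_itv/= => /andP[xy ye] /andP[st ts]; apply: W_ge.
      by rewrite ler0_norm; lra.
    by rewrite gtr0_norm; lra.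
  have := edge_increment xe sub t0 tT' te tet (lexx t) (ltW m0) hm.
  rewrite !G0//; last by apply: sub; rewrite /= in_itv/= xe lexx.
  rewrite subrr leNgt => /negP; apply.
  rewrite mulr_gt0//; first by rewrite addrAC subrr add0r.
  rewrite divr_gt0//; last by rewrite mulr_gt0.
  by rewrite mulr_gt0 ?divr_gt0 ?powR_gt0// opprB addrCA subrr addr0.
move=> x t bx tT.
(* The two remaining times: [0] by the initial condition, [T] by continuity from the left. *)
have cg := continuous_on_slice (cW (isT : (0 <= 2)%N)) bx.
have [_ C0 CT] := (continuous_within_itvP _ T0).1 cg.
move: tT; rewrite in_itv/= => /andP[]; rewrite le_eqVlt => /predU1P[<- _|t0].
  exact: (he_init he bx).
rewrite le_eqVlt => /predU1P[->|tT]; last by apply: oo; rewrite // in_itv/= t0.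
have E : \forall s \near T^'-, W 0 x s = 0.
  near=> s; apply: oo => //; rewrite in_itv/=; apply/andP; split; near: s.
    exact: nbhs_left_gt.
  exact: nbhs_left_lt.
apply: (cvg_unique _ CT); first exact: Rhausdorff.
by apply: cvg_near_cst.
Unshelve. all: end_near. Qed.

Lemma edge_flux_vanish (tau e : R) : 0 < tau -> tau < T -> 0 < e ->
  exists N : R, forall x : R, b x -> N < `|x| ->
    `|\int[@lebesgue_measure R]_(t in `[0, tau]) edge_flux W x t| <= e.
Proof.
have key (p q k : R) : p <= k * 1 -> q <= k * 1 -> 0 < k -> p + q / 2 <= 2 * k.
  by lra.
move=> tau0 tauT e0.
(* With each factor at most [e' <= 1], the two products are at most [e'], so the flux is at most
   [2 * e'] and its integral at most [2 * e' * tau <= e]. *)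
pose e' := Num.min 1 (e / (2 * tau)).
have e'0 : 0 < e' by rewrite lt_min ltr01 divr_gt0// mulr_gt0.
have van (j : nat) (j2 : (j <= 2)%N) :=
  he_vanish he j2 (@segment_compact R 0 T) (@subset_refl _ _) e'0.
have [M0 H0] := van 0%N isT; have [M1 H1] := van 1%N isT; have [M2 H2] := van 2%N isT.
exists (Num.max M0 (Num.max M1 M2)) => x bx.
rewrite !gt_max => /and3P[x0 x1 x2].
have bnd (t : R) : `[0, tau]%classic t -> `|edge_flux W x t| <= 2 * e'.
  move=> tt; have tT : t \in `[0, T]%classic.
    by rewrite inE; exact: subset_itvcc (lexx 0) (ltW tauT) _ tt.
  have W0 := ltW (H0 x t (mem_set bx) tT x0).
  have W1 := ltW (H1 x t (mem_set bx) tT x1).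
  have W2 := ltW (H2 x t (mem_set bx) tT x2).
  have e'1 : e' <= 1 by rewrite ge_min lexx.
  rewrite (le_trans (ler_normB _ _))// normrM [`|_ / 2|]normrM normrM.
  rewrite [`|2^-1|]ger0_norm ?invr_ge0//.
  have P1 : `|W 0 x t| * `|W 2 x t| <= e' * 1.
    by apply: ler_pM => //; exact: le_trans e'1.
  have P2 : `|W 1 x t| * `|W 1 x t| <= e' * 1.
    by apply: ler_pM => //; exact: le_trans e'1.
  exact: key P1 P2 e'0.
have iF := edge_flux_integrable bx (lexx 0) (ltW tauT).
have ccst (c : R) : (@lebesgue_measure R).-integrable `[0, tau] (EFin \o (fun=> c)).
  apply: continuous_compact_integrable; first exact: segment_compact.
  by apply: continuous_subspaceT => y; exact: cvg_cst.
have L1 := @le_normr_Rintegral _ _ _ (@lebesgue_measure R) _ _ (measurable_itv _) iF.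
apply: (le_trans L1).
have L2 := @le_Rintegral _ _ _ (@lebesgue_measure R) _ _ _ (measurable_itv _)
  (integrable_norm iF) (ccst (2 * e')) bnd.
apply: (le_trans L2); rewrite Rintegral_cst//= lebesgue_measure_itv/= lte_fin tau0.
rewrite -EFinD/= subr0 -ler_pdivlMr// -ler_pdivlMl//.
apply: (@le_trans _ _ (e / (2 * tau))); first by rewrite ge_min lexx orbT.
by rewrite invfM mulrCA.
Qed.

Lemma edge_flux_vertex (clip : R -> R) (tau : R) :
  continuous clip -> (forall x, closure b (clip x)) ->
  (forall x, b x -> clip x = x) -> clip 0 = 0 -> 0 <= tau -> tau <= T ->
  \int[@lebesgue_measure R]_(t in `[0, tau]) edge_flux W x t @[x --> within b (nbhs 0)]
  --> \int[@lebesgue_measure R]_(t in `[0, tau]) (V 0 t * V 2 t - V 1 t * V 1 t / 2).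
Proof.
move=> cclip clipb clipE clip0 tau0 tauT.
have [h0 [ch0 hW0 hV0]] := he_ext he (isT : (0 <= 2)%N).
have [h1 [ch1 hW1 hV1]] := he_ext he (isT : (1 <= 2)%N).
have [h2 [ch2 hW2 hV2]] := he_ext he (isT : (2 <= 2)%N).
have sub : `[0, tau] `<=` `[0, T] by exact: subset_itvcc.
pose F x t := h0 x t * h2 x t - h1 x t * h1 x t / 2.
have cF : continuous_on (closure b) `[0, tau] F.
  apply: (continuous_onS (@subset_refl _ _) sub).
  apply: continuous_onB; first exact: continuous_onM.
  by apply: continuous_onM; [exact: continuous_onM|exact: continuous_on_cst].
have C := Rintegral_vertex_cvg cclip clipb clipE clip0 tau0 cF.
have <- : \int[@lebesgue_measure R]_(t in `[0, tau]) F 0 t =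
    \int[@lebesgue_measure R]_(t in `[0, tau]) (V 0 t * V 2 t - V 1 t * V 1 t / 2).
  by apply: eq_Rintegral => t /[!inE] /sub tT; rewrite /F hV0// hV1// hV2.
apply: cvg_trans C; apply: near_eq_cvg.
apply: filterS (withinT b (nbhs_filter (0 : R))) => x bx.
by apply: eq_Rintegral => t /[!inE] /sub tT; rewrite /F /edge_flux hW0// hW1// hW2.
Qed.

End homogeneous_edge_theory.

(** * Sign of the flux on incoming and outgoing edges *)

Section homogeneous_edge_sign.
Context (R : realType) (a T gam : R).
Context (W : nat -> R -> R -> R) (Wt : R -> R -> R) (V : nat -> R -> R).
Context (a01 : 0 < a < 1) (gam0 : 0 < gam).

Let G (tau x : R) := \int[@lebesgue_measure R]_(t in `[0, tau]) edge_flux W x t.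
Let Gv (tau : R) :=
  \int[@lebesgue_measure R]_(t in `[0, tau]) (V 0 t * V 2 t - V 1 t * V 1 t / 2).

Lemma incoming_flux (tau x : R) :
  homogeneous_edge `]-oo, 0[ a T gam W Wt V -> 0 < tau -> tau < T -> x < 0 ->
  0 <= G tau x <= Gv tau.
Proof.
move=> he tau0 tauT x0.
have ob : open (`]-oo, 0[%classic : set R) by exact: interval_open.
have mono (c d : R) : c <= d -> d < 0 -> G tau c <= G tau d.
  move=> cd d0; apply: (edge_mono a01 ob gam0 he cd) => // y /=.
  by rewrite !in_itv/= => /andP[_ /le_lt_trans]; apply.
apply/andP; split.
  apply/ler_addgt0Pr => e e0.
  have [N HN] := edge_flux_vanish he tau0 tauT e0.
  (* A point to the left of [x], beyond [N] in absolute value. *)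
  pose y := - (`|N| + `|x| + 1).
  have N0 : 0 <= `|N| by [].
  have x0' : 0 <= `|x| by [].
  have y0 : y < 0 by rewrite /y; lra.
  have yx : y <= x by have := ler_norm (- x); rewrite normrN /y; lra.
  have Ny : N < `|y| by have := ler_norm N; rewrite (ltr0_norm y0) /y; lra.
  have := HN y; rewrite /= in_itv/= => /(_ y0 Ny).
  have := mono _ _ yx x0; rewrite ler_norml -/(G tau y) => H1 /andP[H2 _].
  by rewrite addrC -lerBlDl sub0r (le_trans H2).
(* This is the minimum of [y] and [0]. *)
pose clip (y : R) := (y - `|y|) / 2.
have clip_le0 y : clip y <= 0.
  by rewrite /clip; have := ler_norm y; lra.
have clip_cvg : continuous clip.
  move=> y; apply: cvgMl; apply: cvgB; first exact: cvg_id.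
  by apply: cvg_norm; exact: cvg_id.
have C := @edge_flux_vertex R `]-oo, 0[ a T gam W Wt V he clip tau clip_cvg.
have EE : `]-oo, 0[%classic = [set y : R | y < 0] by rewrite set_itvNyo.
have {}C : G tau y @[y --> 0^'-] --> Gv tau.
  rewrite EE in C; apply: C.
  - by move=> y; rewrite closure_lt; exact: clip_le0.
  - by move=> y /= y0; rewrite /clip (ltr0_norm y0) opprK mulrDl -splitr.
  - by rewrite /clip normr0 subrr mul0r.
  - exact: ltW.
  - exact: ltW.
apply: (cvgr_to_ge C); near=> y; apply: mono.
  by apply: ltW; near: y; exact: nbhs_left_gt.
by near: y; exact: nbhs_left_lt.
Unshelve. all: end_near. Qed.

Lemma outgoing_flux (tau x : R) :
  homogeneous_edge `]0, +oo[ a T gam W Wt V -> 0 < tau -> tau < T -> 0 < x ->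
  Gv tau <= G tau x <= 0.
Proof.
move=> he tau0 tauT x0.
have ob : open (`]0, +oo[%classic : set R) by exact: interval_open.
have mono (c d : R) : 0 < c -> c <= d -> G tau c <= G tau d.
  move=> c0 cd; apply: (edge_mono a01 ob gam0 he cd) => // y /=.
  by rewrite !in_itv/= andbT => /andP[/(lt_le_trans c0)].
apply/andP; split; last first.
  apply/ler_addgt0Pr => e e0; rewrite add0r.
  have [N HN] := edge_flux_vanish he tau0 tauT e0.
  pose y := `|N| + `|x| + 1.
  have N0 : 0 <= `|N| by [].
  have x0' : 0 <= `|x| by [].
  have y0 : 0 < y by rewrite /y; lra.
  have yx : x <= y by have := ler_norm x; rewrite /y; lra.
  have Ny : N < `|y| by have := ler_norm N; rewrite (gtr0_norm y0) /y; lra.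
  have := HN y; rewrite /= in_itv/= andbT => /(_ y0 Ny).
  have := mono _ _ x0 yx; rewrite ler_norml -/(G tau y) => H1 /andP[_ H2].
  exact: le_trans H2.
(* This is the maximum of [y] and [0]. *)
pose clip (y : R) := (y + `|y|) / 2.
have clip_ge0 y : 0 <= clip y.
  by rewrite /clip; have := ler_norm (- y); rewrite normrN; lra.
have clip_cvg : continuous clip.
  move=> y; apply: cvgMl; apply: cvgD; first exact: cvg_id.
  by apply: cvg_norm; exact: cvg_id.
have C := @edge_flux_vertex R `]0, +oo[ a T gam W Wt V he clip tau clip_cvg.
have EE : `]0, +oo[%classic = [set y : R | 0 < y] by rewrite set_itvoy.
have {}C : G tau y @[y --> 0^'+] --> Gv tau.
  rewrite EE in C; apply: C.
  - by move=> y; rewrite closure_gt; exact: clip_ge0.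
  - by move=> y /= y0; rewrite /clip (gtr0_norm y0) mulrDl -splitr.
  - by rewrite /clip normr0 addr0 mul0r.
  - exact: ltW.
  - exact: ltW.
apply: (cvgr_to_le C); near=> y; apply: mono.
  by near: y; exact: nbhs_right_gt.
by apply: ltW; near: y; exact: nbhs_right_lt.
Unshelve. all: end_near. Qed.

End homogeneous_edge_sign.

(** * Positivity of Gamma *)

(** The antiderivative [s ^ r / r] bounds the integrals over the segments from [1 / (n + 1)] to [1]
    by [1 / r]; these segments exhaust []0, 1]], and monotone convergence concludes. *)
Lemma integral_powR_lty (R : realType) (r : R) : 0 < r ->
  (\int[@lebesgue_measure R]_(s in `]0%R, 1%R]) (s `^ (r - 1))%:E < +oo)%E.
Proof.
move=> r0.
pose F (n : nat) : set R := `[n.+1%:R^-1, 1]%classic.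
have n0 (n : nat) : 0 < n.+1%:R^-1 :> R by rewrite invr_gt0.
have FE : \bigcup_n F n = `]0, 1]%classic.
  apply/seteqP; split => [x [n _]|x] /=.
    by rewrite /F/= !in_itv/= => /andP[nx ->]; rewrite (lt_le_trans (n0 n) nx).
  rewrite in_itv/= => /andP[x0 x1].
  have [n nx] : exists n : nat, n.+1%:R^-1 < x.
    exists (Num.truncn x^-1); rewrite invf_plt ?posrE//.
    exact: truncnS_gt.
  by exists n => //; rewrite /F/= in_itv/= (ltW nx).
have int_n (n : nat) : (\int[@lebesgue_measure R]_(s in F n) (s `^ (r - 1))%:E <= (r^-1)%:E)%E.
  (* For [n = 0] the segment is a point, which the fundamental theorem of calculus excludes. *)
  have [->|n1] := eqVneq n 0%N.
    by rewrite /F invr1 set_itv1 integral_set1 lee_fin invr_ge0 ltW.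
  have lt1 : n.+1%:R^-1 < 1 :> R by rewrite invf_lt1// ltr1n ltnS lt0n.
  have der (x : R) : 0 < x -> is_derive x 1 (fun s => s `^ r / r) (x `^ (r - 1)).
    move=> x0; have D := is_deriveM (is_derive1_powR r x0) (is_derive_cst (r^-1 : R) x 1).
    apply: (is_derive_eq D); rewrite /GRing.scale/= mulr0 add0r mulrA mulVf ?mul1r//.
    by rewrite gt_eqF.
  rewrite (@continuous_FTC2 _ _ (fun s => s `^ r / r))//.
  - rewrite -EFinB lee_fin powR1 mul1r gerBl.
    by rewrite divr_ge0 ?powR_ge0// ltW.
  - apply: derivable_within_continuous => x /[!in_itv]/= /andP[nx _].
    by have [] := is_derive1_powR (r - 1) (lt_le_trans (n0 n) nx).
  - split.
    + move=> x /[!in_itv]/= /andP[nx _].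
      by have [] := der x (lt_trans (n0 n) nx).
    + have [d _] := der _ (n0 n).
      have C : {for n.+1%:R^-1, continuous (fun s : R => s `^ r / r)}.
        by apply: differentiable_continuous; exact/derivable1_diffP.
      exact: cvg_within_filter C.
    + have [d _] := der _ (@ltr01 R).
      have C : {for (1 : R), continuous (fun s : R => s `^ r / r)}.
        by apply: differentiable_continuous; exact/derivable1_diffP.
      exact: cvg_within_filter C.
  - move=> x /[!in_itv]/= /andP[nx _]; rewrite derive1E.
    by have [] := der x (lt_trans (n0 n) nx).
have C : (\int[@lebesgue_measure R]_(s in F n) (s `^ (r - 1))%:E)%E @[n --> \oo]
   --> (\int[@lebesgue_measure R]_(s in `]0%R, 1%R]) (s `^ (r - 1))%:E)%E.
  rewrite -FE; apply: ge0_nondecreasing_set_cvg_integral.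
  - move=> p q pq; rewrite subsetEset => x; rewrite /F /=.
    rewrite !in_itv/= => /andP[px ->]; rewrite andbT (le_trans _ px)//.
    by rewrite lef_pV2 ?posrE// ler_nat.
  - by move=> n; exact: measurable_itv.
  - move=> n; apply/measurable_EFinP.
    exact: measurable_funTS (measurable_powR _).
  - by move=> n x _; rewrite lee_fin powR_ge0.
apply: (@le_lt_trans _ _ (r^-1)%:E); last by rewrite ltry.
rewrite -(cvg_lim _ C)//; apply: lime_le; first by apply/cvg_ex; eexists; exact: C.
by apply: nearW => n; exact: int_n.
Qed.

Lemma integral_expRN_lty (R : realType) :
  (\int[@lebesgue_measure R]_(s in `[1%R, +oo[) (expR (- s))%:E < +oo)%E.
Proof.
have der (x : R) : is_derive x 1 (fun s => - expR (- s)) (expR (- x)).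
  have D1 := is_derive1_comp (is_derive_expR (- x)) (is_deriveN (is_derive_id x 1)).
  have D := is_deriveN D1.
  by apply: (is_derive_eq D); rewrite mulrN1 opprK.
have cts (f : R -> R) d : (forall x : R, is_derive x 1 f (d x)) -> continuous f.
  move=> df x; have [dd _] := df x.
  by apply: differentiable_continuous; exact/derivable1_diffP.
have f0 (x : R) : 1 <= x -> 0 <= expR (- x) by move=> _; exact: expR_ge0.
have cf : {within `[1, +oo[, continuous (fun s : R => expR (- s))}.
  apply: continuous_subspaceT => x.
  apply: (@continuous_comp R R R -%R expR); first exact: opp_continuous.
  exact: continuous_expR.
have Fl : (- expR (- x)) @[x --> +oo] --> (0 : R).
  by rewrite -oppr0; apply: cvgN; exact: cvgr_expR.
have dF (x : R) : 1 < x -> derivable (fun s : R => - expR (- s)) x 1.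
  by move=> _; have [] := der x.
have F1 : (- expR (- x)) @[x --> (1 : R)^'+] --> - expR (- (1 : R)).
  exact: cvg_within_filter (cts _ _ der 1).
have F' : {in `]1, +oo[, derive1 (fun s : R => - expR (- s)) =1 (fun s => expR (- s))}.
  by move=> x _; rewrite derive1E; have [] := der x.
by rewrite (ge0_continuous_FTC2y f0 cf Fl dF F1 F') -EFinB ltry.
Qed.

(** [Gamma] is a real-valued integral, which would be [0] by default if the extended integral were
    infinite, so finiteness has to be proved too. The exponential is at most [1] on []0, 1]] and the
    power at most [1] beyond. *)
Lemma Gamma_gt0 (R : realType) (r : R) : 0 < r < 1 -> 0 < Gamma r.
Proof.
move=> /andP[r0 r1].
pose f (s : R) := s `^ (r - 1) * expR (- s).
have f0 (s : R) : 0 <= f s by rewrite mulr_ge0 ?powR_ge0 ?expR_ge0.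
have mp (D : set R) : measurable_fun D (fun s : R => s `^ (r - 1)).
  exact: measurable_funTS (measurable_powR _).
have me (D : set R) : measurable_fun D (fun s : R => expR (- s)).
  apply: measurable_funTS; apply: measurableT_comp; first exact: measurable_expR.
  exact: oppr_measurable.
have mf (D : set R) : measurable_fun D f by exact: measurable_funM.
have fin : (\int[@lebesgue_measure R]_(s in `]0%R, +oo[) (f s)%:E < +oo)%E.
  rewrite (@itv_bndbnd_setU _ _ (BRight 0) (BRight 1)) ?bnd_simp ?ler01//.
  rewrite ge0_integral_setU//=; last 3 first.
  - by apply/measurable_EFinP; apply: mf.
  - by move=> x _; rewrite lee_fin.
  - apply/disj_setPS => x [] /=; rewrite !in_itv/= => /andP[_ x1].
    by rewrite andbT ltNge x1.
  apply: lte_add_pinfty.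
    apply: le_lt_trans (integral_powR_lty r0); apply: ge0_le_integral => //.
    - by move=> x _; rewrite lee_fin.
    - by apply/measurable_EFinP; apply: mf.
    - by apply/measurable_EFinP; apply: mp.
    - move=> x /=; rewrite in_itv/= => /andP[x0 _]; rewrite lee_fin /f.
      by rewrite ger_pMr ?powR_gt0// -expR0 ler_expR oppr_le0 ltW.
  apply: le_lt_trans (integral_expRN_lty R).
  apply: (@le_trans _ _ (\int[@lebesgue_measure R]_(s in `]1%R, +oo[) (expR (- s))%:E)%E).
    apply: ge0_le_integral => //.
    - by move=> x _; rewrite lee_fin.
    - by apply/measurable_EFinP; apply: mf.
    - by apply/measurable_EFinP; apply: me.
    - move=> x /=; rewrite in_itv/= andbT => x1; rewrite lee_fin /f.
      rewrite ger_pMl ?expR_gt0// -[leRHS](powRr0 x).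
      by apply: ler_powR; [exact: ltW|rewrite subr_le0 ltW].
  apply: ge0_subset_integral => //.
  - by apply/measurable_EFinP; apply: me.
  - by apply: subset_itvr; rewrite bnd_simp.
rewrite /Gamma /Rintegral fine_gt0// fin andbT.
(* The value of the integrand at [2], a lower bound on [[1, 2]] because both factors decrease. *)
pose c : R := 2 `^ (r - 1) * expR (- 2).
have c0 : 0 < c by rewrite mulr_gt0 ?powR_gt0 ?expR_gt0.
apply: (@lt_le_trans _ _ (\int[@lebesgue_measure R]_(s in `[1%R, 2%R]) c%:E)%E).
  rewrite integral_cst//= lebesgue_measure_itv/= lte_fin ltr1n/=.
  by rewrite -EFinD -EFinM lte_fin mulr_gt0// subr_gt0 ltr1n.
apply: (@le_trans _ _ (\int[@lebesgue_measure R]_(s in `[1%R, 2%R]) (f s)%:E)%E).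
  apply: ge0_le_integral => //.
  - by move=> x _; rewrite lee_fin ltW.
  - by apply/measurable_EFinP; apply: mf.
  - move=> x /=; rewrite in_itv/= => /andP[x1 x2]; rewrite lee_fin /c /f.
    have x0 : 0 < x by exact: lt_le_trans x1.
    apply: ler_pM; rewrite ?powR_ge0 ?expR_ge0//.
      have -> : r - 1 = - (1 - r) by ring.
      by rewrite !powRN kernel_inv_le// subr_ge0 ltW.
    by rewrite ler_expR lerN2.
apply: ge0_subset_integral => //.
- by apply/measurable_EFinP; apply: mf.
- by move=> x _; rewrite lee_fin.
- by move=> x /=; rewrite !in_itv/= => /andP[x1 _]; rewrite andbT (lt_le_trans ltr01).
Qed.

(** * Difference of two solutions *)

(** [vertex_value] is a total [lim]; continuity of the extension on the closed edge is what makes it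
    a true limit, and so additive in the difference of two solutions. *)
Lemma vertex_value_extension (R : realType) (b I : set R) (g h : R -> R -> R) t :
  ProperFilter (within b (nbhs (0 : R))) -> closure b 0 ->
  continuous_on (closure b) I h ->
  (forall x s, x \in b -> s \in I -> h x s = g x s) -> I t ->
  vertex_value b g t = h 0 t.
Proof.
move=> PF b0 ch hg It.
have /subspace_continuousP/(_ 0 b0) C := continuous_on_slicex ch It.
apply: cvg_lim; first exact: Rhausdorff.
have {}C : h x t @[x --> within b (nbhs 0)] --> h 0 t.
  have sub : within b (nbhs (0 : R)) `=>` within (closure b) (nbhs (0 : R)).
    move=> U HU; have {}HU : \forall x \near (0 : R), closure b x -> U x := HU.
    change (\forall x \near (0 : R), b x -> U x).
    by near=> x => bx; have := near HU x; apply => //; exact: subset_closure.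
  by move=> U HU; apply: sub; exact: C.
apply: cvg_trans C; apply: near_eq_cvg.
apply: filterS (withinT b (nbhs_filter (0 : R))) => x bx.
by rewrite hg// inE.
Unshelve. all: end_near. Qed.

Lemma derivable_dx (R : realType) (v : R -> R -> R) (j : nat) (x t : R) :
  derivable (fun y => dx j v y t) x 1 ->
  is_derive x 1 (fun y => dx j v y t) (dx j.+1 v x t).
Proof.
move=> D; apply: DeriveDef; first exact: D.
by rewrite /dx derive1nS derive1E.
Qed.

(** Every condition is linear in the function. Besides linearity, [Gamma (1 - rho) != 0] is needed
    to carry the normalising factor of [caputo] to the other side of the equation. *)
Lemma homogeneous_edge_difference (R : realType) (b : set R) (rho T : R)
    (u v : R -> R -> R) :
  0 < rho < 1 -> ProperFilter (within b (nbhs (0 : R))) -> closure b 0 ->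
  regular_on_edge b rho T u -> regular_on_edge b rho T v ->
  (forall x t, x \in b -> t \in `]0, T] ->
    caputo_dt rho u x t - dx 3 u x t = caputo_dt rho v x t - dx 3 v x t) ->
  (forall x, x \in b -> u x 0 = v x 0) ->
  homogeneous_edge b rho T (Gamma (1 - rho))
    (fun j x t => dx j u x t - dx j v x t) (fun x t => dt u x t - dt v x t)
    (fun j t => vertex_value b (dx j u) t - vertex_value b (dx j v) t).
Proof.
have key (p q r s : R) : p - q = r - s -> q - s = p - r by lra.
move=> rho01 PF b0 ru rv equv inituv.
have gam0 : 0 < Gamma (1 - rho).
  by apply: Gamma_gt0; move: rho01 => /andP[r0 r1]; apply/andP; split; lra.
split.
- move=> j x t j2 bx tT; have bx' := mem_set bx.
  have D1 := derivable_dx (regular_derivable_x ru j2 bx' tT).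
  have D2 := derivable_dx (regular_derivable_x rv j2 bx' tT).
  exact: is_deriveB D1 D2.
- move=> x t bx tT; have bx' := mem_set bx.
  have D1 := derivable_dx (regular_derivable_xxx ru bx' tT).
  have D2 := derivable_dx (regular_derivable_xxx rv bx' tT).
  exact: is_deriveB D1 D2.
- move=> j j2.
  have [hu chu hue] := regular_continuous_x ru j2.
  have [hv chv hve] := regular_continuous_x rv j2.
  exists (fun x t => hu x t - hv x t); split.
  + exact: continuous_onB.
  + by move=> x t bx tT; rewrite hue ?hve// inE.
  + move=> t tT; rewrite (vertex_value_extension PF b0 chu hue tT).
    by rewrite (vertex_value_extension PF b0 chv hve tT).
- by apply: continuous_onB; [case: ru|case: rv].
- move=> x t bx tT; have bx' := mem_set bx.
  have D1 := regular_derivable_t ru bx' tT.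
  have D2 := regular_derivable_t rv bx' tT.
  have E1 : is_derive t 1 (u x) (dt u x t).
    by apply: DeriveDef; [exact: D1|rewrite /dt derive1E].
  have E2 : is_derive t 1 (v x) (dt v x t).
    by apply: DeriveDef; [exact: D2|rewrite /dt derive1E].
  exact: is_deriveB E1 E2.
- by apply: continuous_onB; [case: ru|case: rv].
- move=> x t bx tT; have bx' := mem_set bx.
  have I1 := regular_integrable_caputo ru bx' tT.
  have I2 := regular_integrable_caputo rv bx' tT.
  apply: eq_itv_integrable (itv_integrableB I1 I2) => s _.
  by rewrite /caputo_integrand /dt mulrBl.
- move=> x t bx tT; have bx' := mem_set bx.
  have I1 := regular_integrable_caputo ru bx' tT.
  have I2 := regular_integrable_caputo rv bx' tT.
  have EB := @RintegralB _ _ _ (@lebesgue_measure R) _ _ _ (measurable_itv _) I1 I2.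
  have -> : \int[@lebesgue_measure R]_(s in `]0, t[)
      ((dt u x s - dt v x s) / (t - s) `^ rho) =
    \int[@lebesgue_measure R]_(s in `]0, t[)
      (caputo_integrand rho (u x) t s - caputo_integrand rho (v x) t s).
    by apply: eq_Rintegral => s _; rewrite /caputo_integrand /dt mulrBl.
  rewrite EB.
  have -> : dx 3 u x t - dx 3 v x t = caputo_dt rho u x t - caputo_dt rho v x t.
    exact: key (equv x t bx' tT).
  by rewrite /caputo_dt /caputo -mulrBr mulrA divff ?mul1r// gt_eqF.
- by move=> x bx; rewrite /dx /= inituv ?subrr// inE.
- move=> j j2 K cK KT e e0.
  have e20 : 0 < e / 2 by rewrite divr_gt0.
  have [M1 H1] := regular_vanishes_x ru j2 cK KT e20.
  have [M2 H2] := regular_vanishes_x rv j2 cK KT e20.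
  exists (Num.max M1 M2) => x t bx tK; rewrite gt_max => /andP[x1 x2].
  rewrite (le_lt_trans (ler_normB _ _))// [ltRHS]splitr ltrD//.
    exact: H1.
  exact: H2.
Qed.

(** Integrability and value go together because the induction for the value uses the integrability
    of the partial sum. *)
Lemma Rintegral_sum_itv (R : realType) (I : Type) (s : seq I) (A : interval R)
    (F : I -> R -> R) :
  (forall i, (@lebesgue_measure R).-integrable [set` A] (EFin \o F i)) ->
  (@lebesgue_measure R).-integrable [set` A] (EFin \o (fun t => \sum_(i <- s) F i t)) /\
  \int[@lebesgue_measure R]_(t in [set` A]) (\sum_(i <- s) F i t) =
  \sum_(i <- s) \int[@lebesgue_measure R]_(t in [set` A]) F i t.
Proof.
move=> iF; elim: s => [|i s [IH1 IH2]].
  split.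
    have I0 : (@lebesgue_measure R).-integrable [set` A] (EFin \o (fun _ : R => 0 : R)).
      exact: integrable0.
    by apply: eq_itv_integrable I0 => t _; rewrite big_nil.
  rewrite big_nil; under eq_Rintegral do rewrite big_nil.
  by rewrite Rintegral_cst// mul0r.
split.
  apply: eq_itv_integrable (itv_integrableD (iF i) IH1) => t _.
  by rewrite big_cons.
under eq_Rintegral do rewrite big_cons.
rewrite big_cons -IH2.
exact: (@RintegralD _ _ _ (@lebesgue_measure R) _ _ _ (measurable_itv _) (iF i) IH1).
Qed.

Lemma edge_vertex_integrable (R : realType) (b : set R) (a T gam tau : R)
    (W : nat -> R -> R -> R) (Wt : R -> R -> R) (V : nat -> R -> R) :
  homogeneous_edge b a T gam W Wt V -> closure b 0 -> tau <= T ->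
  (@lebesgue_measure R).-integrable `[0, tau]
    (EFin \o (fun t => V 0 t * V 2 t - V 1 t * V 1 t / 2)).
Proof.
move=> he b0 tauT; apply: continuous_compact_integrable; first exact: segment_compact.
have cV (j : nat) : (j <= 2)%N -> {within `[0, tau], continuous (V j)}.
  move=> j2; have [h [ch _ hV]] := he_ext he j2.
  have sub : `[0, tau] `<=` `[0, T] by exact: subset_itvcc.
  have := continuous_subspaceW sub (continuous_on_slice ch b0).
  by apply: subspace_eq_continuous => t /[!inE] /sub; exact: hV.
apply: within_continuousB; first by apply: within_continuousM; exact: cV.
apply: within_continuousM; first by apply: within_continuousM; exact: cV.
by apply: continuous_subspaceT => x; exact: cvg_cst.
Qed.

(** * Algebra of the vertex conditions *)

(** The difference of the two sums of squares is the quadratic form of [B^T *m B - 1%:M] at the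
    vector [z] of the [p i]. The case [z = 0] is separate, definiteness being a condition on nonzero
    vectors. *)
Lemma negative_definite_contraction (R : realType) (k m : nat) (B : 'M[R]_(m, k))
    (p : 'I_k -> R) (q : 'I_m -> R) :
  negative_definite (B^T *m B - 1%:M) ->
  (forall j, q j = \sum_(i < k) B j i * p i) ->
  \sum_(j < m) q j * q j <= \sum_(i < k) p i * p i.
Proof.
move=> [_ nd] qE; pose z : 'cV[R]_k := \col_i p i.
have -> : \sum_(i < k) p i * p i = (z^T *m z) 0 0.
  by rewrite !mxE; apply: eq_bigr => i _; rewrite !mxE.
have -> : \sum_(j < m) q j * q j = (z^T *m (B^T *m B) *m z) 0 0.
  rewrite mulmxA -mulmxA -trmx_mul mxE; apply: eq_bigr => j _.
  have Bz : (B *m z) j 0 = q j.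
    by rewrite mxE qE; apply: eq_bigr => i _; rewrite mxE.
  by rewrite mxE Bz.
have [->|z0] := eqVneq z 0; first by rewrite !mulmx0.
have := nd z z0; rewrite mulmxBr mulmx1 mulmxBl mxE [X in _ + X]mxE subr_lt0.
exact: ltW.
Qed.

(** All the values [V n 0] are one number divided by [a n]. Hence the sums of [V n 0 * V n 2] over
    incoming and over outgoing edges are that number times the two sides of the condition on second
    derivatives, and cancel. What remains is half of the outgoing squares of [V n 1] minus the
    incoming ones. *)
Lemma vertex_flux_le0 (R : realType) (k m : nat) (hk : (0 < k)%N)
    (a : 'I_(k + m) -> R) (B : 'M[R]_(m, k)) (V : 'I_(k + m) -> nat -> R) :
  a (first_edge m hk) = 1 ->
  (forall n, n != first_edge m hk -> a n != 0) ->
  negative_definite (B^T *m B - 1%:M) ->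
  (forall n, n != first_edge m hk ->
    V (first_edge m hk) 0%N = a n * V n 0%N) ->
  (forall j : 'I_m, V (rshift k j) 1%N =
    \sum_(i < k) B j i * V (lshift m i) 1%N) ->
  \sum_(i < k) (a (lshift m i))^-1 * V (lshift m i) 2%N =
  \sum_(j < m) (a (rshift k j))^-1 * V (rshift k j) 2%N ->
  \sum_(i < k) (V (lshift m i) 0%N * V (lshift m i) 2%N -
    V (lshift m i) 1%N * V (lshift m i) 1%N / 2) -
  \sum_(j < m) (V (rshift k j) 0%N * V (rshift k j) 2%N -
    V (rshift k j) 1%N * V (rshift k j) 1%N / 2) <= 0.
Proof.
move=> a1 an0 nd V0 V1 V2.
have V0E n : V n 0%N = V (first_edge m hk) 0%N * (a n)^-1.
  (* The normalisation of the first coefficient to [1] lets one formula cover every edge. *)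
  have [->|n1] := eqVneq n (first_edge m hk); first by rewrite a1 invr1 mulr1.
  by rewrite (V0 n n1) mulrC mulrA mulVf ?mul1r// an0.
have S i : V i 0%N * V i 2%N = V (first_edge m hk) 0%N * ((a i)^-1 * V i 2%N).
  by rewrite V0E mulrA.
rewrite !sumrB.
under eq_bigr do rewrite S.
under [X in _ - (X - _)]eq_bigr do rewrite S.
rewrite -!mulr_sumr V2 -!mulr_suml.
have := negative_definite_contraction nd V1.
set x := _ * _; set p := \sum_(i < k) _; set q := \sum_(j < m) _.
lra.
Qed.

(** * Topology of the edges at the vertex *)

Lemma edge_open (R : realType) (k m : nat) (n : 'I_(k + m)) : open (edge R n).
Proof. by rewrite /edge; case: ifP => _; exact: interval_open. Qed.

Lemma edge_closure0 (R : realType) (k m : nat) (n : 'I_(k + m)) :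
  closure (edge R n) 0.
Proof.
rewrite /edge; case: ifP => _.
  by rewrite set_itvNyo closure_lt /=.
by rewrite set_itvoy closure_gt /=.
Qed.

Lemma edge_proper_filter (R : realType) (k m : nat) (n : 'I_(k + m)) :
  ProperFilter (within (edge R n) (nbhs (0 : R))).
Proof.
rewrite /edge; case: ifP => _.
  by rewrite set_itvNyo; exact: at_left_proper_filter.
by rewrite set_itvoy; exact: at_right_proper_filter.
Qed.

Lemma edge_lshift (R : realType) (k m : nat) (i : 'I_k) :
  edge R (lshift m i) = `]-oo, 0[%classic.
Proof. by rewrite /edge /= ltn_ord. Qed.

Lemma edge_rshift (R : realType) (k m : nat) (j : 'I_m) :
  edge R (rshift k j) = `]0, +oo[%classic.
Proof. by rewrite /edge /= ltnNge leq_addr. Qed.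

Unset Implicit Arguments.
Set Strict Implicit.
Set Printing Implicit Defensive.

Theorem theorem2 (R : realType) (k m : nat) (hk : (0 < k)%N) (hm : (0 < m)%N)
    (T : R) (hT : 0 < T)
    (alpha : 'I_(k + m) -> R) (halpha : forall n, 0 < alpha n < 1)
    (a : 'I_(k + m) -> R) (ha1 : a (first_edge m hk) = 1)
    (ha : forall n, n != first_edge m hk -> a n != 0)
    (B : 'M[R]_(m, k))
    (f : 'I_(k + m) -> R -> R -> R) (u0 : 'I_(k + m) -> R -> R)
    (hB : negative_definite (B^T *m B - 1%:M))
    (u v : 'I_(k + m) -> R -> R -> R)
    (hu : regular_solution hk T alpha a B f u0 u)
    (hv : regular_solution hk T alpha a B f u0 v) :
  forall (n : 'I_(k + m)) (x t : R), x \in edge R n -> t \in `[0, T] ->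
    u n x t = v n x t.
Proof.
have sum_mulrB (l : nat) (c p q : 'I_l -> R) : \sum_(i < l) c i * (p i - q i) =
    \sum_(i < l) c i * p i - \sum_(i < l) c i * q i.
  by rewrite -sumrB; apply: eq_bigr => i _; rewrite mulrBr.
pose W n j x t := dx j (u n) x t - dx j (v n) x t.
pose Wt n x t := dt (u n) x t - dt (v n) x t.
pose V n j t := vertex_value (edge R n) (dx j (u n)) t -
  vertex_value (edge R n) (dx j (v n)) t.
have he n : homogeneous_edge (edge R n) (alpha n) T (Gamma (1 - alpha n))
    (W n) (Wt n) (V n).
  apply: homogeneous_edge_difference.
  - exact: halpha.
  - exact: edge_proper_filter.
  - exact: edge_closure0.
  - exact: solution_regular hu n.
  - exact: solution_regular hv n.
  - move=> x t xn tT.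
    exact: etrans (solution_equation hu xn tT) (esym (solution_equation hv xn tT)).
  - by move=> x xn; rewrite (solution_initial hu xn) (solution_initial hv xn).
have gam0 n : 0 < Gamma (1 - alpha n).
  apply: Gamma_gt0; have /andP[r0 r1] := halpha n.
  by rewrite subr_gt0 r1 gtrBl r0.
pose Phi n t := V n 0%N t * V n 2%N t - V n 1%N t * V n 1%N t / 2.
have Phi_le0 t : t \in `[0, T] ->
    \sum_(i < k) Phi (lshift m i) t - \sum_(j < m) Phi (rshift k j) t <= 0.
  move=> tT; apply: (@vertex_flux_le0 R k m hk a B (fun n j => V n j t)) => //.
  - move=> n n1; rewrite /V mulrBr.
    rewrite -(solution_vertex hu n1 tT) -(solution_vertex hv n1 tT).
    by [].
  - move=> j; rewrite /V (solution_vertex_x hu j tT) (solution_vertex_x hv j tT).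
    exact: esym (sum_mulrB _ _ _ _).
  - have Eu := solution_vertex_xx hu tT; have Ev := solution_vertex_xx hv tT.
    exact: etrans (sum_mulrB _ _ _ _)
      (etrans (congr2 (fun p q => p - q) Eu Ev) (esym (sum_mulrB _ _ _ _))).
pose Gv tau n := \int[@lebesgue_measure R]_(t in `[0, tau]) Phi n t.
(* The numbers [Gv] on incoming edges and [- Gv] on outgoing ones are nonnegative with total at most
   [0], so each is [0]. *)
have Gv0 tau n : 0 < tau -> tau < T -> Gv tau n = 0.
  move=> tau0 tauT.
  have iPhi n' : (@lebesgue_measure R).-integrable `[0, tau] (EFin \o Phi n').
    exact: edge_vertex_integrable (he n') (edge_closure0 n') (ltW tauT).
  have Gin i : 0 <= Gv tau (lshift m i).
    have hei := he (lshift m i); rewrite edge_lshift in hei.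
    (* Any point of the edge would do in place of [-1]: the flux there separates [0] from the vertex
       value. *)
    have /andP[] := incoming_flux (halpha _) (gam0 _) hei tau0 tauT (ltrN10 R).
    exact: le_trans.
  have Gout j : 0 <= - Gv tau (rshift k j).
    have hej := he (rshift k j); rewrite edge_rshift in hej.
    have /andP[] := outgoing_flux (halpha _) (gam0 _) hej tau0 tauT ltr01.
    by move=> H1 H2; rewrite oppr_ge0; exact: le_trans H1 H2.
  have [il El] := Rintegral_sum_itv (index_enum 'I_k) (fun i => iPhi (lshift m i)).
  have [ir Er] := Rintegral_sum_itv (index_enum 'I_m) (fun j => iPhi (rshift k j)).
  have S0 : \sum_(i < k) Gv tau (lshift m i) + \sum_(j < m) - Gv tau (rshift k j) <= 0.
    rewrite sumrN /Gv -El -Er.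
    have EB := @RintegralB _ _ _ (@lebesgue_measure R) _ _ _ (measurable_itv _) il ir.
    rewrite -EB.
    have i0 : (@lebesgue_measure R).-integrable `[0, tau] (EFin \o (fun _ : R => 0 : R)).
      exact: integrable0.
    have le0 (t : R) : `[0, tau]%classic t ->
        \sum_(i < k) Phi (lshift m i) t - \sum_(j < m) Phi (rshift k j) t <= 0.
      by move=> tt; apply: Phi_le0; exact: subset_itvcc (lexx 0) (ltW tauT) _ tt.
    have := @le_Rintegral _ _ _ (@lebesgue_measure R) _ _ _ (measurable_itv _)
      (itv_integrableB il ir) i0 le0.
    by rewrite Rintegral_cst// mul0r.
  have S1 : 0 <= \sum_(i < k) Gv tau (lshift m i) by apply: sumr_ge0 => i _.
  have S2 : 0 <= \sum_(j < m) - Gv tau (rshift k j) by apply: sumr_ge0 => j _.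
  have E1 : \sum_(i < k) Gv tau (lshift m i) = 0.
    by apply/eqP; rewrite eq_le S1 andbT (le_trans _ S0)// lerDl.
  have E2 : \sum_(j < m) - Gv tau (rshift k j) = 0.
    by apply/eqP; rewrite eq_le S2 andbT (le_trans _ S0)// lerDr.
  case: (split_ordP n) => [i ->|j ->].
    exact: (psumr_eq0P (fun i _ => Gin i) E1).
  by apply/eqP; rewrite -oppr_eq0; apply/eqP;
    exact: (psumr_eq0P (fun j _ => Gout j) E2).
(* At each point of an edge the integrated flux lies between [0], its limit at infinity, and its
   vertex value, now known to be [0]. *)
have G0 n tau x : 0 < tau -> tau < T -> edge R n x ->
    \int[@lebesgue_measure R]_(t in `[0, tau]) edge_flux (W n) x t = 0.
  move=> tau0 tauT; have := Gv0 tau n tau0 tauT; have := he n.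
  case: (split_ordP n) => [i ->|j ->].
    rewrite edge_lshift => hei Gi; rewrite /= in_itv/= => x0.
    have := incoming_flux (halpha _) (gam0 _) hei tau0 tauT x0.
    by rewrite -/(Gv tau _) Gi => /le_anti/esym.
  rewrite edge_rshift => hej Gj; rewrite /= in_itv/= andbT => x0.
  have := outgoing_flux (halpha _) (gam0 _) hej tau0 tauT x0.
  by rewrite -/(Gv tau _) Gj => /le_anti/esym.
move=> n x t /set_mem xn tT; apply/eqP; rewrite -subr_eq0; apply/eqP.
have := edge_eq0 (halpha n) (@edge_open R k m n) (gam0 n) (he n) hT (G0 n) xn tT.
by rewrite /W /dx !derive1n0.
Qed.
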